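(* Let $\mathsf{Mot}$ be the module of (localized) point-counting functions of schemes of finite type over $\mathbf{Z}$, and let $\mathsf{Graphs}\subseteq \mathsf{Mot}$ be the $\mathsf{R}$-submodule generated by the functions $[Y_G]$, where $G$ runs over all finite graphs. Then $$\mathsf{Graphs}=\mathsf{Mot}.$$
   Context: Let $\mathcal{Q}$ be the set of prime powers $q=p^m$ ($p$ prime, $m\ge 1$). For a scheme $X$ of finite type over $\mathbf{Z}$, $[X]:\mathcal{Q}\to\mathbf{Z}$ denotes the function $q\mapsto \# X(\mathbf{F}_q)$. $\mathsf{Mot}^+$ is the additive group of functions generated by all $[X]$, $X$ a scheme of finite type over $\mathbf{Z}$; it is a ring since $[X\times Y]=[X][Y]$, and a $\mathbf{Z}[q]$-module since $[\mathbf{A}^1]=q$. Let $\mathsf{S}\subset\mathbf{Z}[q]$ be the saturated multiplicative system generated by the polynomials $q^n-q$, $n>1$ (saturated: closed under taking divisors). Elements of $\mathsf{S}$ do not vanish on $\mathcal{Q}$. Put $\mathsf{R}=\mathsf{S}^{-1}\mathbf{Z}[q]$ and $\mathsf{Mot}=\mathsf{S}^{-1}\mathsf{Mot}^+$; elements of both are viewed as functions $\mathcal{Q}\to\mathbf{Q}$. Graphs are finite; loops and multiple edges are allowed. For a graph $G$ with vertex set $V(G)$ and edge set $E$, a spanning tree is a subgraph $T$ with $V(T)=V(G)$ that is a tree (as a CW complex $b_0(T)=1$, $b_1(T)=0$). With one variable $x_e$ for each edge $e$, let $P_G=\sum_T\prod_{e\notin T}x_e$, the sum running over all spanning trees $T$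 of $G$ (so $P_G=0$ if $G$ is not connected). $Y_G$ is the complement in $\mathbf{A}^E_{\mathbf{Z}}$ of the hypersurface $V(P_G)$; thus $[Y_G](q)=\#\{x\in\mathbf{F}_q^E : P_G(x)\ne 0\}$. *)

(* Defs.v *)
(* Mathematical Components *)
From HB Require Import structures.
From mathcomp Require Import all_boot all_order all_fingroup all_algebra all_field.
From mathcomp Require Import mpoly.

Set Implicit Arguments.
Unset Strict Implicit.
Unset Printing Implicit Defensive.

Import GRing.Theory.
Local Open Scope ring_scope.

(** * Schemes of finite type over Z *)

(* Schemes are taken in the functor-of-points formulation of Demazure-Gabriel:
   a scheme is a functor on commutative rings that is a sheaf for the Zariski
   topology and has a covering by open affine subfunctors.  Rings may be zero,
   hence [comPzRingType]. *)

(* The two functor laws are stated up to pointwise equality of morphisms, so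
   that [ract f] depends only on the underlying function of [f]. *)
Record ring_functor := RingFunctor {
  points :> comPzRingType -> Type;
  ract : forall R S : comPzRingType, {rmorphism R -> S} -> points R -> points S;
  ract_id : forall (R : comPzRingType) (f : {rmorphism R -> R}),
    f =1 id -> forall x, ract f x = x;
  ract_comp : forall (R S T : comPzRingType) (f : {rmorphism R -> S})
    (g : {rmorphism S -> T}) (h : {rmorphism R -> T}),
    h =1 g \o f -> forall x, ract h x = ract g (ract f x)
}.

Definition generates_unit_ideal (R : comPzRingType) (I : R -> Prop) : Prop :=
  exists (n : nat) (a c : 'I_n -> R),
    (forall i, I (a i)) /\ \sum_(i < n) c i * a i = 1.

(* [S], through [l], is the localization R[1/f]. *)
Definition is_localization (R S : comPzRingType) (f : R)
    (l : {rmorphism R -> S}) : Prop :=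
  [/\ exists u, l f * u = 1,
      forall s, exists r n, l f ^+ n * s = l r
    & forall r, l r = 0 -> exists n, f ^+ n * r = 0].

(* Exactness of X(R) -> prod_i X(R_{f_i}) => prod_{i,j} X(R_{f_i f_j}) whenever
   the f_i generate the unit ideal. *)
Definition zariski_sheaf (X : ring_functor) : Prop :=
  forall (R : comPzRingType) (n : nat) (f : 'I_n -> R)
    (Ri : 'I_n -> comPzRingType) (l : forall i, {rmorphism R -> Ri i})
    (Rij : 'I_n -> 'I_n -> comPzRingType)
    (l1 : forall i j, {rmorphism Ri i -> Rij i j})
    (l2 : forall i j, {rmorphism Ri j -> Rij i j})
    (l12 : forall i j, {rmorphism R -> Rij i j}),
    generates_unit_ideal (fun a => exists i, a = f i) ->
    (forall i, is_localization (f i) (l i)) ->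
    (forall i j, is_localization (f i * f j) (l12 i j)) ->
    (forall i j, l1 i j \o l i =1 l12 i j) ->
    (forall i j, l2 i j \o l j =1 l12 i j) ->
  forall x : forall i, X (Ri i),
    (forall i j, ract (l1 i j) (x i) = ract (l2 i j) (x j)) ->
  exists! y : X R, forall i, ract (l i) y = x i.

Definition subfunctor (X : ring_functor)
    (U : forall R : comPzRingType, X R -> Prop) : Prop :=
  forall (R S : comPzRingType) (f : {rmorphism R -> S}) (x : X R),
    U R x -> U S (ract f x).

(* For every x : Spec A -> X the preimage of U is the open subscheme of Spec A
   which is the complement of V(I), for some set I of functions on Spec A. *)
Definition open_subfunctor (X : ring_functor)
    (U : forall R : comPzRingType, X R -> Prop) : Prop :=
  subfunctor U /\
  forall (A : comPzRingType) (x : X A), exists I : A -> Prop,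
    forall (R : comPzRingType) (f : {rmorphism A -> R}),
      U R (ract f x) <->
      generates_unit_ideal (fun b : R => exists2 a, I a & b = f a).

(* Yoneda: the point u of U(A) identifies Spec A with U. *)
Definition represents (X : ring_functor)
    (U : forall R : comPzRingType, X R -> Prop)
    (A : comPzRingType) (u : X A) : Prop :=
  [/\ forall (R : comPzRingType) (f : {rmorphism A -> R}), U R (ract f u),
      forall (R : comPzRingType) (f g : {rmorphism A -> R}),
        ract f u = ract g u -> f =1 g
    & forall (R : comPzRingType) (x : X R),
        U R x -> exists f : {rmorphism A -> R}, ract f u = x].

Definition finitely_generated_ring (A : comPzRingType) : Prop :=
  exists (n : nat) (p : {rmorphism {mpoly int[n]} -> A}),
    forall a, exists P, p P = a.

(* A family of open subfunctors covers X when it does so on points with values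
   in every field. *)
Definition scheme_of_finite_type (X : ring_functor) : Prop :=
  zariski_sheaf X /\
  exists (n : nat) (U : 'I_n -> forall R : comPzRingType, X R -> Prop),
    [/\ forall i, open_subfunctor (U i),
        forall i, exists (A : comPzRingType) (u : X A),
          finitely_generated_ring A /\ represents (U i) u
      & forall (K : fieldType) (x : X K), exists i, U i K x].

(** * Functions on prime powers *)

(* The prime power p ^ m; p and m are determined by it. *)
Record prime_power := PrimePower {
  pp_base : nat;
  pp_exp : nat;
  pp_base_prime : prime pp_base;
  pp_exp_gt0 : (0 < pp_exp)%N
}.

Definition pp_val (q : prime_power) : nat := (pp_base q ^ pp_exp q)%N.
Coercion pp_val : prime_power >-> nat.

Definition Fq (q : prime_power) : finFieldType :=
  s2val (pPrimePowerField (pp_base_prime q) (pp_exp_gt0 q)).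

Definition has_card (T : Type) (n : nat) : Prop :=
  exists f : T -> 'I_n, bijective f.

(* f = [X] *)
Definition counts_points (X : ring_functor) (f : prime_power -> rat) : Prop :=
  forall q : prime_power, exists2 n : nat, has_card (X (Fq q)) n & f q = n%:R.

(* The K-submodule of the functions generated by B, K being a set of functions
   acting by multiplication. *)
Inductive span (K B : (prime_power -> rat) -> Prop) :
    (prime_power -> rat) -> Prop :=
| span_gen f : B f -> span K B f
| span_zero : span K B (fun=> 0)
| span_add f g : span K B f -> span K B g -> span K B (fun q => f q + g q)
| span_scale a f : K a -> span K B f -> span K B (fun q => a q * f q)
| span_ext f g : f =1 g -> span K B f -> span K B g.

Definition constZ (a : prime_power -> rat) : Prop :=
  exists z : int, a =1 fun=> z%:~R.

Definition MotPlus : (prime_power -> rat) -> Prop :=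
  span constZ
    (fun f => exists X, scheme_of_finite_type X /\ counts_points X f).

(* The indeterminate 'X of {poly int} plays the role of q. *)
Inductive satS : {poly int} -> Prop :=
| satS_gen n : (1 < n)%N -> satS ('X^n - 'X)
| satS_one : satS 1
| satS_mul s t : satS s -> satS t -> satS (s * t)
| satS_div s t : satS (s * t) -> satS s.

Definition pval (s : {poly int}) (q : prime_power) : rat :=
  (s.[(q : nat)%:Z])%:~R.

Definition locR (a : prime_power -> rat) : Prop :=
  exists p s : {poly int}, satS s /\ forall q, a q = pval p q / pval s q.

Definition Mot (f : prime_power -> rat) : Prop :=
  exists (g : prime_power -> rat) (s : {poly int}),
    [/\ MotPlus g, satS s & forall q, f q = g q / pval s q].

(** * Graphs *)

(* The order of the two ends of an edge is an arbitrary orientation, used only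
   to write down the boundary map. *)
Record graph := Graph {
  vertices : finType;
  edges : finType;
  ends : edges -> vertices * vertices
}.

(* The cellular boundary map, acting on row vectors, of the subgraph with all
   the vertices of G and with edge set T. *)
Definition boundary (G : graph) (T : {set edges G}) :
    'M[rat]_(#|T|, #|vertices G|) :=
  \matrix_(i, j) (((ends (enum_val i)).2 == enum_val j)%:R
                  - ((ends (enum_val i)).1 == enum_val j)%:R).

Definition b0 (G : graph) (T : {set edges G}) : nat :=
  \rank (cokermx (boundary T)).

Definition b1 (G : graph) (T : {set edges G}) : nat :=
  \rank (kermx (boundary T)).

Definition spanning_tree (G : graph) (T : {set edges G}) : bool :=
  (b0 T == 1)%N && (b1 T == 0)%N.

Definition graph_poly (G : graph) : {mpoly int[#|edges G|]} :=
  \sum_(T : {set edges G} | spanning_tree T)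
    \prod_(e : edges G | e \notin T) 'X_(enum_rank e).

(* [Y_G] *)
Definition countY (G : graph) (q : prime_power) : rat :=
  #|[set x : {ffun edges G -> Fq q} |
      (map_mpoly intr (graph_poly G)).@[fun i => x (enum_val i)] != 0]|%:R.

Definition Graphs : (prime_power -> rat) -> Prop :=
  span locR (fun f => exists G : graph, f =1 countY G).

(* Main.v *)
(* One inclusion holds because Y_G is the affine scheme t P_G = 1.

   For the other one, replacing an edge by 0, 1 or 2 parallel edges turns counts
   of P_G into counts of the dual polynomial (the sum over the spanning trees T
   of the products over e in T), which by the matrix-tree theorem is a generic
   symmetric determinant when G has a vertex joined to all the others.  Hence
   Graphs contains the numbers of invertible symmetric matrices with prescribed
   off-diagonal zeros and, by bordering, those of such matrices of any given
   rank.  A symmetric matrix of rank 3 is the matrix of a bilinear form on some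
   vectors of K^3, so that Graphs counts the configurations of points and lines
   with prescribed incidences.  Sums and products are encoded by incidences,
   with no degenerate cases, so all systems of polynomial equations over Z are
   reached.  Finally, a scheme of finite type is a disjoint union of locally
   closed pieces which, by Hilbert's basis theorem, are given by such systems. *)
From HB Require Import structures.
From mathcomp Require Import all_boot all_order all_fingroup all_algebra all_field.
From mathcomp Require Import mpoly ring zify.
From mathcomp Require Import mxabelem.
From mathcomp Require Import boolp.
Require Import Defs.

Set Implicit Arguments.
Unset Strict Implicit.
Unset Printing Implicit Defensive.

Import GRing.Theory Num.Theory.
Local Open Scope ring_scope.

(** * The coefficient ring and the span of the graph functions *)

(** Every step is an identity of counts over a fixed F_q, up to a factor that is a unit of R: q (q -
    1)^2 for each edge, powers of q - 1 for scalars, a pivot q^a (q^b - 1) for ranks. Replacing an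
    edge works because the tree polynomial is linear in the pair attached to that edge, so that its
    nonvanishing is a function on the projective line. Its sums for 0, 1 and 2 copies involve only
    the value at (1 : 0), the value at (0 : 1) and the sum over the other points; eliminating the
    value at (0 : 1) leaves the sum over all (1 : t). In the matrix counts obtained, a diagonal
    entry can be required neither to vanish nor to be nonzero. This obstacle explains the extra
    invertible block placed off the diagonal before vectors are read off. Incidence constructions of
    sums and products tend to break down when points coincide. Here no incidence is forbidden, every
    point and line has a coordinate prescribed nonzero that normalises it, and the scales of the
    axes stay unknown; a value may be 0 or repeat another one. *)

Lemma satSX : satS 'X.
Proof.
apply: (@satS_div _ ('X - 1)); rewrite mulrBr mulr1 -expr2; exact: satS_gen.
Qed.

Lemma satSXn n : satS 'X^n.
Proof. by elim: n => [|n IH]; [exact: satS_one | rewrite exprS; apply: satS_mul satSX IH]. Qed.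

Lemma satSXnB1 n : (0 < n)%N -> satS ('X^n - 1).
Proof.
move=> n_gt0; apply: (@satS_div _ 'X); rewrite mulrBl mul1r -exprSr.
exact: satS_gen.
Qed.

Lemma satSXB1 : satS ('X - 1).
Proof. exact: (@satSXnB1 1). Qed.

Lemma satS_exp s n : satS s -> satS (s ^+ n).
Proof.
by move=> hs; elim: n => [|n IH]; [exact: satS_one | rewrite exprS; apply: satS_mul].
Qed.

Lemma pp_gt1 (q : prime_power) : (1 < q)%N.
Proof. by rewrite /pp_val -[1%N](exp1n (pp_exp q)) ltn_exp2r ?pp_exp_gt0 ?prime_gt1 ?pp_base_prime. Qed.

Lemma pval1 q : pval 1 q = 1. Proof. by rewrite /pval hornerE. Qed.
Lemma pval0 q : pval 0 q = 0. Proof. by rewrite /pval horner0. Qed.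
Lemma pval_nat n q : pval n%:R q = n%:R.
Proof. by rewrite /pval hornerMn hornerC rmorph_nat. Qed.
Lemma pvalX q : pval 'X q = q%:R. Proof. by rewrite /pval hornerX. Qed.
Lemma pvalC c q : pval c%:P q = c%:~R. Proof. by rewrite /pval hornerC. Qed.
Lemma pvalD s t q : pval (s + t) q = pval s q + pval t q.
Proof. by rewrite /pval hornerD rmorphD. Qed.
Lemma pvalN s q : pval (- s) q = - pval s q.
Proof. by rewrite /pval hornerN rmorphN. Qed.
Lemma pvalM s t q : pval (s * t) q = pval s q * pval t q.
Proof. by rewrite /pval hornerM rmorphM. Qed.
Lemma pval_exp s n q : pval (s ^+ n) q = pval s q ^+ n.
Proof. by rewrite /pval horner_exp rmorphXn. Qed.
Definition pvalE := (pval0, pval1, pval_nat, pvalX, pvalC, pvalD, pvalN, pvalM, pval_exp).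

Lemma satS_neq0 s q : satS s -> pval s q != 0.
Proof.
elim=> {s} [n n_gt1||s t _ hs _ ht|s t _]; rewrite ?pvalE.
- rewrite subr_eq0 -natrX eqr_nat -{2}[q : nat]expn1 eqn_exp2l ?pp_gt1 //.
  by rewrite gtn_eqF.
- by rewrite oner_eq0.
- by rewrite mulf_neq0.
- by rewrite mulf_eq0 negb_or => /andP[].
Qed.

Lemma card_Fq (q : prime_power) : #|Fq q| = q.
Proof. exact: (s2valP' (pPrimePowerField (pp_base_prime q) (pp_exp_gt0 q))). Qed.

Lemma locR_poly p : locR (pval p).
Proof. by exists p, 1; split=> [|q]; [exact: satS_one | rewrite pval1 divr1]. Qed.

Lemma locR_ext a b : a =1 b -> locR a -> locR b.
Proof. by move=> e [p [s [hs h]]]; exists p, s; split=> // q; rewrite -e. Qed.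

Lemma locR_inv s : satS s -> locR (fun q => (pval s q)^-1).
Proof. by move=> hs; exists 1, s; split=> // q; rewrite pval1 mul1r. Qed.

Lemma locRM a b : locR a -> locR b -> locR (fun q => a q * b q).
Proof.
move=> [p [s [hs h]]] [p' [s' [hs' h']]]; exists (p * p'), (s * s').
by split=> [|q]; [exact: satS_mul | rewrite h h' !pvalM mulf_div].
Qed.

Lemma locR_prod (I : finType) (a : I -> prime_power -> rat) :
  (forall i, locR (a i)) -> locR (fun q => \prod_i a i q).
Proof.
move=> ha; elim: (index_enum I) => [|i r IH].
  by apply: locR_ext (locR_poly 1) => q; rewrite big_nil pval1.
by apply: locR_ext (locRM (ha i) IH) => q; rewrite big_cons.
Qed.

Lemma GraphsZ a f : locR a -> Graphs f -> Graphs (fun q => a q * f q).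
Proof. exact: span_scale. Qed.

Lemma GraphsD f g : Graphs f -> Graphs g -> Graphs (fun q => f q + g q).
Proof. exact: span_add. Qed.

Lemma GraphsZp p f : Graphs f -> Graphs (fun q => pval p q * f q).
Proof. by move=> hf; apply: GraphsZ hf; apply: locR_poly. Qed.

Lemma GraphsN f : Graphs f -> Graphs (fun q => - f q).
Proof.
by move=> /(GraphsZp (-1)); apply: span_ext => q; rewrite pvalN pval1 mulN1r.
Qed.

Lemma GraphsB f g : Graphs f -> Graphs g -> Graphs (fun q => f q - g q).
Proof. by move=> hf /GraphsN; apply: GraphsD. Qed.

Lemma Graphs_sum (I : finType) (f : I -> prime_power -> rat) :
  (forall i, Graphs (f i)) -> Graphs (fun q => \sum_i f i q).
Proof.
move=> hf; elim: (index_enum I) => [|i r IH].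
  by apply: span_ext (span_zero _ _) => q; rewrite big_nil.
by apply: span_ext (GraphsD (hf i) IH) => q; rewrite big_cons.
Qed.

Lemma Graphs_div s f g : satS s -> Graphs g ->
  (forall q, pval s q * f q = g q) -> Graphs f.
Proof.
move=> hs /(GraphsZ (locR_inv hs)) hg e; apply: span_ext hg => q.
by rewrite -e mulKf ?satS_neq0.
Qed.

(** * Spanning trees and Laplacians *)

Section Laplacian.

Variables (n : nat) (E : finType) (b : E -> 'I_n -> int).

Definition lap (R : comNzRingType) (y : E -> R) : 'M[R]_n :=
  \matrix_(i, j) \sum_e y e * (b e i * b e j)%:~R.

Definition lap_coef (f : {ffun 'I_n -> E}) : int :=
  (\prod_i b (f i) i) * \det (\matrix_(i, j) b (f i) j).

(** Multilinearity in the rows: row i of [lap y] is a combination of the vectors [b e] with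
    coefficients [y e * b e i], and [f] selects one [e] for each row. *)
Lemma det_lap_ffun (R : comNzRingType) (y : E -> R) :
  \det (lap y) = \sum_(f : {ffun 'I_n -> E}) (\prod_i y (f i)) * (lap_coef f)%:~R.
Proof.
rewrite /determinant; transitivity (\sum_(s : 'S_n) \sum_(f : {ffun 'I_n -> E})
   (\prod_i y (f i)) * ((-1) ^+ s * \prod_i (b (f i) i * b (f i) (s i)))%:~R).
  apply: eq_bigr => s _; under eq_bigr => i _ do rewrite mxE.
  rewrite bigA_distr_bigA big_distrr /=; apply: eq_bigr => f _.
  rewrite big_split /= mulrCA rmorphM rmorphXn rmorphN1; congr (_ * (_ * _)).
  by rewrite rmorph_prod.
rewrite exchange_big; apply: eq_bigr => f _; rewrite -big_distrr /=; congr (_ * _).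
rewrite -rmorph_sum /lap_coef /determinant big_distrr /=; congr (_%:~R).
apply: eq_bigr => s _; rewrite big_split /= mulrCA; congr (_ * (_ * _)).
by apply: eq_bigr => i _; rewrite mxE.
Qed.

Lemma lap_coef_inj (f : {ffun 'I_n -> E}) : lap_coef f != 0 -> injective f.
Proof.
move=> f_n0 i j eq_f; apply: contraNeq f_n0 => ne_ij; apply/eqP.
rewrite /lap_coef (determinant_alternate ne_ij) ?mulr0 // => k.
by rewrite !mxE eq_f.
Qed.

(* When T has n elements this is the square of the minor with rows T of the
   matrix b, so that det_lap below is the Cauchy-Binet formula. *)
Definition tau (T : {set E}) : int :=
  \det (lap (fun e => (e \in T)%:R : int)).

Lemma tauE (T : {set E}) : #|T| = n ->
  tau T = \sum_(f : {ffun 'I_n -> E} | f @: setT == T) lap_coef f.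
Proof.
move=> T_n; rewrite /tau det_lap_ffun [RHS]big_mkcond; apply: eq_bigr => f _.
have [/lap_coef_inj f_inj|] := boolP (lap_coef f != 0); last first.
  by rewrite negbK => /eqP ->; rewrite mulr0 if_same.
have [fT | fNT] := eqVneq.
  rewrite big1 ?mul1r ?intz // => i _.
  by rewrite -fT imset_f.
(* The image of an injective [f] has as many elements as T, so it leaves T unless it equals T. *)
have [i fi] : exists i, f i \notin T.
  apply/existsP; apply: contraNT fNT => /existsPn fT.
  rewrite eqEcard card_imset // cardsT card_ord T_n leqnn andbT.
  by apply/subsetP => _ /imsetP[i _ ->]; have := fT i; rewrite negbK.
by rewrite (bigD1 i) //= (negPf fi) !mul0r.
Qed.

Lemma det_lap (R : comNzRingType) (y : E -> R) :
  \det (lap y) = \sum_(T : {set E} | #|T| == n) (\prod_(e in T) y e) * (tau T)%:~R.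
Proof.
transitivity (\sum_(T : {set E} | #|T| == n) \sum_(f : {ffun 'I_n -> E} |
    f @: setT == T) (\prod_i y (f i)) * (lap_coef f)%:~R).
  rewrite det_lap_ffun.
  rewrite (bigID (fun f : {ffun 'I_n -> E} => #|f @: setT| == n)) /=.
  rewrite [X in _ + X]big1 ?addr0 => [|f].
    rewrite (partition_big (fun f : {ffun 'I_n -> E} => f @: setT)
      (fun T : {set E} => #|T| == n)) //=.
    apply: eq_bigr => T /eqP T_n; apply: eq_bigl => f.
    by case: (_ =P T) => [->|]; rewrite ?T_n ?eqxx ?andbF.
  apply: contraNeq => h; rewrite card_imset ?cardsT ?card_ord //.
  apply: lap_coef_inj; apply: contraNneq h => ->; by rewrite mulr0.
apply: eq_bigr => T /eqP T_n; rewrite tauE // rmorph_sum big_distrr /=.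
apply: eq_bigr => f /eqP fT.
have [/lap_coef_inj f_inj|] := boolP (lap_coef f != 0); last first.
  by rewrite negbK => /eqP ->; rewrite !mulr0.
congr (_ * _); rewrite -fT big_imset /=; last by move=> x y' _ _ /f_inj.
by apply: eq_bigl => i; rewrite inE.
Qed.

End Laplacian.

Lemma sign3_mul (c d : int) (o : bool) : c \in [:: 1; -1] -> d \in [:: 0; 1; -1] ->
  c * ((-1) ^+ o * d) \in [:: 0; 1; -1].
Proof.
rewrite !inE => /orP[]/eqP-> /or3P[]/eqP->; case: o;
by rewrite ?expr0 ?expr1 ?mulr0 ?mul1r ?mulN1r ?opprK ?eqxx ?orbT.
Qed.

(* Expanding along a row with a single nonzero entry, or else finding the
   vector (1, ..., 1) in the kernel. *)
Lemma det_incidence n (u v : 'I_n -> option 'I_n) :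
  \det (\matrix_(i, j) ((v i == Some j)%:R - (u i == Some j)%:R : int))
    \in [:: 0; 1; -1].
Proof.
elim: n u v => [|n IH] u v; first by rewrite det_mx00.
set B := \matrix_(_, _) _.
have [/existsP[i ui]|/existsPn uvN] := boolP [exists i, (u i == None) (+) (v i == None)].
  have [j [c [cE Bi]]] : exists j, exists c : int, c \in [:: 1; -1] /\
      forall k, B i k = c * (k == j)%:R.
    case Eu: (u i) ui => [j|]; case Ev: (v i) => [j'|] //= _.
      exists j, (-1); rewrite !inE eqxx; split=> // k.
      by rewrite mxE Eu Ev sub0r mulN1r eq_sym.
    by exists j', 1; rewrite !inE eqxx; split=> // k; rewrite mxE Eu Ev subr0 mul1r eq_sym.
  rewrite (expand_det_row _ i) (bigD1 j) //= big1 ?addr0 => [|k /negPf kj]; last first.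
    by rewrite Bi kj mulr0 mul0r.
  rewrite Bi eqxx mulr1 /cofactor.
  set D := \det _; have DE : D \in [:: 0; 1; -1].
    (* Deleting column j turns the ends equal to j into [None], so the minor has the same form; the
       ends are optional for the sake of this closure. *)
    have := IH (fun k => obind (unlift j) (u (lift i k))) (fun k => obind (unlift j) (v (lift i k))).
    set D' := \det _; suff -> : D = D' by [].
    congr (\det _); apply/matrixP => k l; rewrite !mxE.
    suff H w : (w == Some (lift j l)) = (obind (unlift j) w == Some l) by rewrite !H.
    case: w => //= w; rewrite !(inj_eq (@Some_inj _)).
    case: unliftP => [m ->|->]; first by rewrite (inj_eq (lift_inj (h:=j))).
    by rewrite (negPf (neq_lift _ _)).
  rewrite -signr_odd.
  exact: sign3_mul.
have B1 : B *m (const_mx 1 : 'cV_n.+1) = 0.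
  apply/matrixP => i j; rewrite !mxE.
  under eq_bigr => k _ do rewrite !mxE mulr1.
  have sum1 w : \sum_(k < n.+1) (Some w == Some k)%:R = 1 :> int.
    rewrite (bigD1 w) //= eqxx big1 ?addr0 // => k.
    by rewrite (inj_eq (@Some_inj _)) eq_sym => /negPf->.
  rewrite sumrB; have := uvN i; case: (u i) (v i) => [w|] [w'|] //= _.
    by rewrite !sum1 subrr.
  by rewrite subrr.
have : \det B *: (const_mx 1 : 'cV_n.+1) = 0.
  by rewrite -mul_scalar_mx -mul_adj_mx -mulmxA B1 mulmx0.
by move=> /matrixP /(_ 0 0); rewrite !mxE mulr1 => ->; rewrite !inE eqxx.
Qed.

Section Trees.

Variables (n : nat) (E : finType) (en : E -> option 'I_n * option 'I_n).

Definition edge_row (e : E) (i : 'I_n) : int :=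
  ((en e).2 == Some i)%:R - ((en e).1 == Some i)%:R.

Let G := @Graph (option 'I_n) E en.

Let reduced (T : {set E}) : 'M[int]_(#|T|, n) :=
  \matrix_(i, j) edge_row (enum_val i) j.

(** The Gram determinant is the square of a determinant equal to 0, 1 or -1, so it only records
    invertibility. *)
Lemma det_gram_incidence m (B : 'M[int]_(m, n)) (u v : 'I_m -> option 'I_n) :
  m = n -> (forall i j, B i j = (v i == Some j)%:R - (u i == Some j)%:R) ->
  \det (B^T *m B) = (row_free (map_mx intr B : 'M[rat]_(m, n)))%:R.
Proof.
move=> e; move: B u v; rewrite e => B u v BE.
have := det_incidence u v.
have <- : B = \matrix_(i, j) ((v i == Some j)%:R - (u i == Some j)%:R : int).
  by apply/matrixP => i j; rewrite mxE BE.
rewrite row_free_unit unitmxE unitfE det_map_mx intr_eq0 det_mulmx det_tr.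
by rewrite !inE => /or3P[]/eqP->.
Qed.

(** The rows of the boundary matrix sum to 0, so the column of the root is determined by the others
    and deleting it loses nothing. *)
Lemma boundary_row_free (T : {set E}) :
  row_free (boundary (G:=G) T) = row_free (map_mx intr (reduced T) : 'M[rat]_(#|T|, n)).
Proof.
set B := boundary (G:=G) T; set C := map_mx _ _.
pose J : 'M[rat]_(#|{: option 'I_n}|, n) := \matrix_(i, j) (enum_val i == Some j)%:R.
have sumV (f : option 'I_n -> rat) :
    \sum_(i < #|{: option 'I_n}|) f (enum_val i) = f None + \sum_i f (Some i).
  rewrite -(big_enum_val f) (bigD1 None) //=; congr (_ + _).
  rewrite (reindex_omap Some id) => [|[]] //.
  by apply: eq_bigl => i; rewrite /= !eqxx.
have CE : C = B *m J.
  apply/matrixP => i j; rewrite !mxE.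
  under eq_bigr => k _ do rewrite !mxE.
  pose f v : rat := ((((en (enum_val i)).2 == v)%:R - ((en (enum_val i)).1 == v)%:R) *
                     (v == Some j)%:R).
  rewrite (sumV f) {1}/f mulr0 add0r (bigD1 j) //= /f eqxx mulr1.
  rewrite big1 ?addr0 => [|k]; first by rewrite /edge_row rmorphB !rmorph_nat.
  by rewrite (inj_eq (@Some_inj _)) => /negPf->; rewrite mulr0.
apply/idP/idP => [/row_freeP[B' BB']|]; last first.
  rewrite CE => /eqP rk; rewrite /row_free eqn_leq rank_leq_row /=.
  by rewrite -{1}rk mxrankM_maxl.
apply: inj_row_free => v vC.
have vB1 : v *m B *m (const_mx 1 : 'cV_#|{: option 'I_n}|) = 0.
  rewrite -mulmxA; suff -> : B *m (const_mx 1 : 'cV_#|{: option 'I_n}|) = 0 by rewrite mulmx0.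
  apply/matrixP => i j; rewrite !mxE.
  under eq_bigr => k _ do rewrite !mxE mulr1.
  rewrite sumrB.
  have sum1 w : \sum_(k < #|{: option 'I_n}|) (w == enum_val k)%:R = 1 :> rat.
    rewrite -(big_enum_val (fun x => (w == x)%:R)) (bigD1 w) //= eqxx.
    by rewrite big1 ?addr0 // => k /negPf; rewrite eq_sym => ->.
  by rewrite !sum1 subrr.
have vBS j : (v *m B) 0 (enum_rank (Some j)) = 0.
  have /matrixP/(_ 0 j) := vC; rewrite CE mulmxA mxE.
  rewrite (bigD1 (enum_rank (Some j))) //= big1 => [|k kj].
    by rewrite !mxE enum_rankK eqxx mulr1 addr0.
  rewrite [X in _ * X]mxE (_ : (_ == _) = false) ?mulr0 //.
  by apply: contraNF kj => /eqP <-; rewrite enum_valK.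
suff vB : v *m B = 0 by rewrite -[v]mulmx1 -BB' mulmxA vB mul0mx.
have vBN : (v *m B) 0 (enum_rank None) = 0.
  have /matrixP/(_ 0 0) := vB1; rewrite mxE [RHS]mxE => <-; symmetry.
  pose g x := (v *m B) 0 (enum_rank x).
  rewrite (eq_bigr (fun k => g (enum_val k))) => [|k _]; last first.
    by rewrite [const_mx _ _ _]mxE mulr1 /g enum_valK.
  by rewrite sumV big1 ?addr0 // => i _; exact: vBS.
apply/matrixP => i j; rewrite ord1 [RHS]mxE -[j]enum_valK.
by case: (enum_val j) => [k|]; [exact: vBS | exact: vBN].
Qed.

(** With n edges on n + 1 vertices, b_0 = 1 and b_1 = 0 both say that the boundary matrix has rank
    n. Together with [det_lap] this is the weighted matrix-tree theorem. *)
Lemma spanning_tree_tau (T : {set E}) : #|T| = n ->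
  tau edge_row T = (spanning_tree (G:=G) T)%:R.
Proof.
move=> T_n.
have -> : tau edge_row T = \det ((reduced T)^T *m reduced T).
  congr (\det _); apply/matrixP => i j; rewrite !mxE.
  under [RHS]eq_bigr => k _ do rewrite !mxE.
  rewrite -(big_enum_val (fun e => edge_row e i * edge_row e j)) [RHS]big_mkcond.
  apply: eq_bigr => e _; rewrite intz; case: (e \in T); by rewrite ?mul1r ?mul0r.
rewrite (@det_gram_incidence _ _ (fun k => (en (enum_val k)).1) (fun k => (en (enum_val k)).2)) //;
  last by move=> i j; rewrite mxE.
rewrite -boundary_row_free; congr (nat_of_bool _)%:R.
rewrite /spanning_tree /b0 /b1 mxrank_coker mxrank_ker /row_free.
have := rank_leq_row (boundary (G := G) T).
have cV : #|vertices G| = n.+1 by rewrite /= card_option card_ord.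
move: (\rank _) => r; rewrite T_n cV; lia.
Qed.

Lemma spanning_tree_card (T : {set E}) : spanning_tree (G:=G) T -> #|T| = n.
Proof.
rewrite /spanning_tree /b0 /b1 mxrank_coker mxrank_ker.
have := rank_leq_row (boundary (G := G) T).
have cV : #|vertices G| = n.+1 by rewrite /= card_option card_ord.
by move: (\rank _) => r; rewrite cV; change #|edges G| with #|E|; move: #|T| => t; lia.
Qed.

End Trees.

(** * Replacing an edge by parallel edges *)

Section CoordinateSums.

Variables (E Z : finType) (R : comNzRingType).

Definition upd (z : {ffun E -> Z}) e a : {ffun E -> Z} :=
  [ffun e' => if e' == e then a else z e'].

(** [c] only selects a representative among the functions that agree away from [e]. *)
Lemma sum_ffun_coord (c : Z) e (F : {ffun E -> Z} -> R) :
  \sum_z F z = \sum_(z : {ffun E -> Z} | z e == c) \sum_a F (upd z e a).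
Proof.
rewrite (partition_big (fun z => upd z e c) (fun z => z e == c)) /=; last first.
  by move=> z _; rewrite ffunE eqxx.
apply: eq_bigr => z /eqP ze.
rewrite (reindex_onto (fun a => upd z e a) (fun z' => z' e)) /=.
  apply: eq_bigl => a; rewrite ffunE eqxx eqxx andbT; apply/eqP/ffunP => e'.
  by rewrite !ffunE; case: eqP => // ->; rewrite ze.
move=> z' /eqP <-; apply/ffunP => e'; rewrite !ffunE.
by case: eqP => // ->.
Qed.

(** The weights are exchanged one coordinate at a time, the others being frozen; an identity local
    to one edge thus becomes global. *)
Lemma eq_sum_prod_weights (mu nu : E -> Z -> R) (N : {ffun E -> Z} -> R) :
  (forall e z, \sum_a mu e a * N (upd z e a) = \sum_a nu e a * N (upd z e a)) ->
  \sum_(z : {ffun E -> Z}) (\prod_e mu e (z e)) * N z = \sum_(z : {ffun E -> Z}) (\prod_e nu e (z e)) * N z.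
Proof.
move=> eqN.
pose H (r : seq E) := \sum_(z : {ffun E -> Z})
  (\prod_e (if e \in r then mu e (z e) else nu e (z e))) * N z.
have -> : \sum_(z : {ffun E -> Z}) (\prod_e mu e (z e)) * N z = H (enum E).
  by apply: eq_bigr => z _; congr (_ * _); apply: eq_bigr => e _; rewrite mem_enum.
have -> : \sum_(z : {ffun E -> Z}) (\prod_e nu e (z e)) * N z = H [::] by [].
elim: (enum E) (enum_uniq E) => //= e r IH /andP[er ur]; rewrite -IH // {IH ur}.
have [z0|Z0] := pickP [pred z : Z | true]; last first.
  have Z0E (z : {ffun E -> Z}) : False by have := Z0 (z e).
  by rewrite /H !big1 // => z.
move=> _; rewrite /H !(sum_ffun_coord z0 e); apply: eq_bigr => z _.
pose w (a : Z) := \prod_(e' | e' != e) (if e' \in r then mu e' (z e') else nu e' (z e')).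
rewrite (eq_bigr (fun a => w a * (mu e a * N (upd z e a)))) => [|a _]; last first.
  rewrite (bigD1 e) //= inE eqxx ffunE eqxx mulrA (mulrC (w a)); congr (_ * _ * _).
  by apply: eq_bigr => e' /negPf ne; rewrite inE ffunE ne.
rewrite -big_distrr eqN [RHS](eq_bigr (fun a => w a * (nu e a * N (upd z e a)))) => [|a _].
  by rewrite -big_distrr.
rewrite (bigD1 e) //= (negPf er) ffunE eqxx mulrA (mulrC (w a)); congr (_ * _ * _).
by apply: eq_bigr => e' /negPf ne; rewrite ffunE ne.
Qed.

(** Push-forward of a product measure along [s], applied in each coordinate. *)
Lemma sum_ffun_comp (X : finType) (s : X -> Z) (w : E -> X -> R) (N : {ffun E -> Z} -> R) :
  \sum_(x : {ffun E -> X}) (\prod_e w e (x e)) * N [ffun e => s (x e)] =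
  \sum_(z : {ffun E -> Z}) (\prod_e \sum_p w e p * (s p == z e)%:R) * N z.
Proof.
under [RHS]eq_bigr => z _ do rewrite bigA_distr_bigA big_distrl /=.
rewrite exchange_big; apply: eq_bigr => x _ /=.
rewrite (bigD1 [ffun e => s (x e)]) //= [X in _ + X]big1 => [|z zN].
  rewrite addr0; congr (_ * _); apply: eq_bigr => e _.
  by rewrite ffunE eqxx mulr1.
have [e he] : exists e, s (x e) != z e.
  apply/existsP; apply: contraNT zN => /existsPn h; apply/eqP/ffunP => e.
  by rewrite ffunE; have := h e; rewrite negbK => /eqP.
by rewrite (bigD1 e) //= (negPf he) mulr0 !mul0r.
Qed.

End CoordinateSums.

(* The second entry is the coefficient of the spanning trees through an edge
   replaced by j parallel copies, among two copies with values x and y (the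
   remaining ones being loops); the first one is that of the other trees. *)
Definition par (R : nzRingType) (j : 'I_3) (x : R * R) : R * R :=
  (x.1 * x.2, match val j with 0 => 0 | 1 => x.2 | _ => x.1 + x.2 end).

(** * Sums over the two variables attached to one edge *)

Section EdgeGadget.

Variables (K : finFieldType) (h : K * K -> rat).
Hypothesis h0 : h (0, 0) = 0.
Hypothesis hZ : forall c x y, c != 0 -> h (c * x, c * y) = h (x, y).

Local Notation q := (#|K|%:R : rat).
Local Notation u := (\sum_(t : K | t != 0) h (1, t)).

Lemma card_unitsR : #|[pred x : K | x != 0]|%:R = q - 1.
Proof. by rewrite (cardC1 (0 : K)) -subn1 natrB //; apply/card_gt0P; exists 0. Qed.

Lemma sum_nonzero (a : rat) : \sum_(x : K | x != 0) a = (q - 1) * a.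
Proof. by rewrite sumr_const -card_unitsR mulr_natl. Qed.

Lemma hx0 x : x != 0 -> h (x, 0) = h (1, 0).
Proof. by move=> x0; have := @hZ x 1 0 x0; rewrite mulr1 mulr0. Qed.

Lemma h0x x : x != 0 -> h (0, x) = h (0, 1).
Proof. by move=> x0; have := @hZ x 0 1 x0; rewrite mulr1 mulr0. Qed.

Lemma sum_split0 (F : K -> rat) : \sum_x F x = F 0 + \sum_(x | x != 0) F x.
Proof. by rewrite (bigD1 0). Qed.

Lemma sum_par0 : \sum_x h (par ord0 x) = (q - 1) ^+ 2 * h (1, 0).
Proof.
rewrite -(pair_bigA _ (fun x y => h (par ord0 (x, y)))) /= sum_split0.
rewrite big1 ?add0r => [|y _]; last by rewrite /par /= mul0r.
rewrite (eq_bigr (fun=> (q - 1) * h (1, 0))) => [|x x0].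
  by rewrite sum_nonzero expr2 mulrA.
rewrite sum_split0 /par /= mulr0 h0 add0r -sum_nonzero; apply: eq_bigr => y y0.
by rewrite hx0 ?mulf_neq0.
Qed.

(** For y nonzero the pair (xy, y) is the point (x : 1), and x = 1/t brings it to the form (1 : t)
    when x is nonzero. *)
Lemma sum_par1 : \sum_x h (par 1 x) = (q - 1) * (h (0, 1) + u).
Proof.
rewrite -(pair_bigA _ (fun x y => h (par 1 (x, y)))) /= exchange_big sum_split0 /par /=.
rewrite big1 ?add0r => [|y _]; last by rewrite mulr0.
rewrite -sum_nonzero; apply: eq_bigr => y y0; rewrite sum_split0 mul0r h0x //.
congr (_ + _); rewrite (reindex_onto (fun t => t^-1) (fun t => t^-1)) => [|t _]; last exact: invrK.
apply: eq_big => [t|t /andP[t0 _]]; first by rewrite invrK eqxx andbT invr_eq0.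
have := @hZ t^-1 1 t t0; rewrite mulr1 mulVf; last by rewrite -invr_eq0.
move=> <-.
by rewrite -(@hZ y t^-1 1 y0) mulr1 mulrC.
Qed.

(** The pair is (xy, x + y). For x nonzero put y = x s: up to scaling it becomes (x s, 1 + s). The
    values s = 0 and s = -1 give (0 : 1) and (1 : 0); for each other s, the point runs once over the
    (1 : t) with t nonzero as x varies. There are q - 2 such s in every characteristic, since 0 and
    -1 always differ. *)
Lemma sum_par2 :
  \sum_x h (par 2%:R x) = (q - 2%:R) * u + 2%:R * (q - 1) * h (0, 1) + (q - 1) * h (1, 0).
Proof.
rewrite -(pair_bigA _ (fun x y => h (par 2%:R (x, y)))) /= sum_split0 /par /=.
rewrite sum_split0 addr0 mul0r h0 add0r.
have -> : \sum_(y | y != 0) h (0 * y, 0 + y) = (q - 1) * h (0, 1).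
  by rewrite -sum_nonzero; apply: eq_bigr => y y0; rewrite mul0r add0r h0x.
have -> : \sum_(x | x != 0) \sum_y h (x * y, x + y) =
   \sum_s \sum_(x : K | x != 0) h (x * s, 1 + s).
  rewrite [RHS]exchange_big; apply: eq_bigr => x x0.
  rewrite (reindex_onto (fun s => x * s) (fun y => x^-1 * y)) => [|y _]; last by rewrite mulVKf.
  apply: eq_big => [s|s _]; first by rewrite mulKf // eqxx.
  by have := @hZ x (x * s) (1 + s) x0; rewrite mulrDr mulr1 => ->.
rewrite sum_split0 addr0.
have -> : \sum_(x | x != 0) h (x * 0, 1) = (q - 1) * h (0, 1).
  by rewrite -sum_nonzero; apply: eq_bigr => x _; rewrite mulr0.
rewrite (bigD1 (-1)) ?oppr_eq0 ?oner_eq0 //= subrr.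
have -> : \sum_(x | x != 0) h (x * -1, 0) = (q - 1) * h (1, 0).
  rewrite -sum_nonzero; apply: eq_bigr => x x0.
  by rewrite hx0 // mulf_neq0 ?oppr_eq0 ?oner_eq0.
rewrite [X in _ + (_ + (_ + X))](eq_bigr (fun=> u)) => [|s /andP[s0 s1]]; last first.
  have s1' : 1 + s != 0 by apply: contraNneq s1 => e; rewrite -(addKr 1 s) e addr0.
  rewrite (reindex_onto (fun t => (1 + s) / (s * t)) (fun x => (1 + s) / (s * x))) => [|x x0]; last first.
    by field; rewrite s0 s1' x0.
  apply: eq_big => [t|t /andP[t0 _]].
    have [->|t0] := eqVneq t 0; first by rewrite mulr0 invr0 mulr0 eqxx.
    rewrite mulf_neq0 ?invr_eq0 ?mulf_neq0 //=; apply/esym/eqP; apply/eqP.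
    suff -> : (1 + s) / (s * ((1 + s) / (s * t))) = t by rewrite eqxx.
    by field; rewrite s0 s1' t0.
  have {}t0 : t != 0.
    by apply: contraNneq t0 => ->; rewrite mulr0 invr0 mulr0.
  have st : (1 + s) / t != 0 by rewrite mulf_neq0 ?invr_eq0.
  by rewrite -(@hZ _ 1 t st) mulr1 divfK //; congr (h (_, _)); field; rewrite s0 t0.
rewrite sumr_const -[_ *+ #|_|]mulr_natl.
have -> : #|[pred i : K | (i != 0) && (i != -1)]|%:R = q - 2%:R.
  have n1 : (0 : K) != -1 by rewrite eq_sym oppr_eq0 oner_eq0.
  have := cardC (pred2 (0 : K) (-1)); rewrite card2 n1 => <-.
  rewrite natrD [in RHS]addrC addKr; congr (_%:R); apply: eq_card => x.
  by rewrite !inE negb_or.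
ring.
Qed.

(** The coefficients solve the linear system given by the three sums above: [h (0, 1)] cancels,
    while [h (1, 0)] and [u] get the same factor q (q - 1)^2. *)
Lemma sum_affine : q * (q - 1) ^+ 2 * \sum_t h (1, t) =
  (2%:R * q - 1) * \sum_x h (par ord0 x) + 2%:R * (q - 1) ^+ 2 * \sum_x h (par 1 x)
  - (q - 1) ^+ 2 * \sum_x h (par 2%:R x).
Proof. by rewrite sum_par0 sum_par1 sum_par2 sum_split0; ring. Qed.

(** The spare factor q gives deleted edges the same normalisation as the edges kept by
    [sum_affine]. *)
Lemma sum_deleted : q * (q - 1) ^+ 2 * h (1, 0) = q * \sum_x h (par ord0 x).
Proof. by rewrite sum_par0 mulrA. Qed.

End EdgeGadget.

Definition ieval n (K : comNzRingType) (v : 'I_n -> K) : {rmorphism {mpoly int[n]} -> K} :=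
  (meval v) \o (map_mpoly intr).

Lemma ievalE n (K : comNzRingType) (v : 'I_n -> K) (P : {mpoly int[n]}) :
  (map_mpoly intr P).@[v] = ieval v P.
Proof. by []. Qed.

Lemma ievalX n (K : comNzRingType) (v : 'I_n -> K) i : ieval v 'X_i = v i.
Proof. by rewrite -ievalE map_mpolyX mevalXU. Qed.

Lemma graph_poly_eval (G : graph) (K : comNzRingType) (x : edges G -> K) :
  (map_mpoly intr (graph_poly G)).@[fun i => x (enum_val i)] =
  \sum_(T : {set edges G} | spanning_tree T) \prod_(e | e \notin T) x e.
Proof.
rewrite ievalE rmorph_sum; apply: eq_bigr => T _; rewrite rmorph_prod.
by apply: eq_bigr => e _; rewrite ievalX enum_rankK.
Qed.

Lemma big_pair (R : Type) (idx : R) (op : Monoid.com_law idx) (I J : finType) (F : I * J -> R) :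
  \big[op/idx]_p F p = \big[op/idx]_i \big[op/idx]_j F (i, j).
Proof. by rewrite (pair_bigA _ (fun i j => F (i, j))); apply: eq_bigr => -[]. Qed.

(** * Multigraphs and their tree polynomials *)

Section Multigraph.

Variables (n : nat) (E : finType) (en : E -> option 'I_n * option 'I_n).
Variable k : {ffun E -> 'I_3}.

(** There are always two copies of an edge, those beyond its multiplicity being loops at the root.
    The edge type is then independent of [k], and a loop merely multiplies the polynomial by its
    variable. *)
Definition multi_ends (e : E * bool) : option 'I_n * option 'I_n :=
  if (e.2 < k e.1)%N then en e.1 else (None, None).

Definition multigraph : graph := @Graph (option 'I_n) (E * bool)%type multi_ends.

(** Multihomogeneous form of the spanning tree polynomial: the pairs (x, 1) give P_G and the pairs
    (1, y) its dual. *)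
Definition tree_poly (R : comNzRingType) (z : E -> R * R) : R :=
  \sum_(T : {set E} | #|T| == n)
    (tau (edge_row en) T)%:~R * \prod_e (if e \in T then (z e).2 else (z e).1).

Definition multi_poly (R : comNzRingType) (x : E * bool -> R) : R :=
  \sum_(T : {set E * bool} | #|T| == n)
    (tau (edge_row multi_ends) T)%:~R * \prod_(e | e \notin T) x e.

Definition par_at (R : comNzRingType) (x : E * bool -> R) (e : E) : R * R :=
  par (k e) (x (e, false), x (e, true)).

(** Factoring out all the variables leaves the Laplacian determinant with weights 1/x, where
    parallel edges add up and loops disappear. Multiplying the total weight [y e] back by the two
    variables of [e] gives [par]. *)
Lemma multi_poly_unit (F : fieldType) (x : E * bool -> F) :
  (forall e, x e != 0) -> multi_poly x = tree_poly (par_at x).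
Proof.
move=> x0; pose y e : F := \sum_(t : bool) (t < k e)%:R * (x (e, t))^-1.
transitivity ((\prod_e x e) * \det (lap (edge_row multi_ends) (fun e => (x e)^-1))).
  rewrite det_lap big_distrr; apply: eq_bigr => T _ /=.
  rewrite mulrA [RHS]mulrC; congr (_ * _).
  rewrite [in RHS](bigID (mem T)) /= mulrAC -big_split /=.
  by rewrite [X in _ = X * _]big1 ?mul1r // => e _; rewrite mulfV.
have -> : lap (edge_row multi_ends) (fun e => (x e)^-1) = lap (edge_row en) y.
  apply/matrixP => i j; rewrite !mxE.
  rewrite big_pair; apply: eq_bigr => e _; rewrite big_distrl; apply: eq_bigr => t _ /=.
  rewrite -[RHS]mulrA [RHS]mulrCA; congr (_ * _); rewrite /edge_row /multi_ends /=.
  by case: ifP => _; rewrite ?mul1r // subrr !mul0r.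
rewrite det_lap big_distrr; apply: eq_bigr => T _ /=.
rewrite mulrA mulrC; congr (_ * _).
rewrite [X in _ * X]big_mkcond big_pair -big_split /=.
apply: eq_bigr => e _; rewrite big_bool /=.
have {x0} [x0 x1] := (x0 (e, false), x0 (e, true)).
case: ifP => _; last by rewrite mulr1 mulrC.
rewrite /y big_bool /par_at /par /=.
by case: (k e) => -[|[|[|]]] //= _; field; rewrite ?x0 ?x1.
Qed.

Lemma multi_poly_morph (A B : comNzRingType) (phi : {rmorphism A -> B}) x :
  phi (multi_poly x) = multi_poly (phi \o x).
Proof.
rewrite rmorph_sum; apply: eq_bigr => T _; rewrite rmorphM rmorph_int; congr (_ * _).
exact: rmorph_prod.
Qed.

Lemma tree_poly_morph (A B : comNzRingType) (phi : {rmorphism A -> B}) x :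
  phi (tree_poly (par_at x)) = tree_poly (par_at (phi \o x)).
Proof.
rewrite rmorph_sum; apply: eq_bigr => T _; rewrite rmorphM rmorph_int; congr (_ * _).
rewrite rmorph_prod; apply: eq_bigr => e _; rewrite /par_at /par /=.
case: ifP => _; last by rewrite rmorphM.
by case: (k e) => -[|[|[|]]] //= _; rewrite ?rmorph0 ?rmorphD.
Qed.

(* Both sides are polynomials in x, so it is enough to compare them for
   invertible x, namely the indeterminates in the fraction field. *)
Lemma multi_polyE (R : comNzRingType) (x : E * bool -> R) :
  multi_poly x = tree_poly (par_at x).
Proof.
pose X (e : E * bool) : {mpoly int[#|{: E * bool}|]} := 'X_(enum_rank e).
have XE : multi_poly X = tree_poly (par_at X).
  apply/eqP; rewrite -tofrac_eq multi_poly_morph tree_poly_morph; apply/eqP.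
  apply: multi_poly_unit => e; rewrite /= tofrac_eq0 /X.
  by rewrite -msize_poly_eq0 msizeX.
pose phi := ieval (fun i : 'I_#|{: E * bool}| => x (enum_val i)).
have xE : x =1 phi \o X.
  by move=> e; rewrite -{1}[e]enum_rankK; symmetry; exact: ievalX.
have -> : multi_poly x = multi_poly (phi \o X).
  by apply: eq_bigr => T _; congr (_ * _); apply: eq_bigr => e _.
have -> : tree_poly (par_at x) = tree_poly (par_at (phi \o X)).
  apply: eq_bigr => T _; congr (_ * _); apply: eq_bigr => e _.
  by rewrite /par_at -!xE.
by rewrite -multi_poly_morph -tree_poly_morph XE.
Qed.

Lemma countY_multigraph q :
  countY multigraph q =
  \sum_(x : {ffun E -> Fq q * Fq q})
    (tree_poly (fun e => par (k e) (x e)) != 0)%:R.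
Proof.
rewrite /countY -sum1_card natr_sum big_mkcond /=.
pose f (x : {ffun E -> Fq q * Fq q}) : {ffun E * bool -> Fq q} :=
  [ffun e => if e.2 then (x e.1).2 else (x e.1).1].
pose g (x : {ffun E * bool -> Fq q}) : {ffun E -> Fq q * Fq q} :=
  [ffun e => (x (e, false), x (e, true))].
have fK : cancel f g by move=> x; apply/ffunP => e; rewrite !ffunE -surjective_pairing.
have gK : cancel g f by move=> x; apply/ffunP => -[e []]; rewrite !ffunE.
rewrite (reindex f) /=; last by exists g => x _; [exact: fK | exact: gK].
apply: eq_bigr => x _; rewrite inE.
have -> : (map_mpoly intr (graph_poly multigraph)).@[fun i => f x (enum_val i)] =
    tree_poly (fun e => par (k e) (x e)).
  rewrite (graph_poly_eval (G := multigraph) (f x)).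
  transitivity (multi_poly (f x)).
    rewrite [RHS]big_mkcond [LHS]big_mkcond; apply: eq_bigr => T _.
    case: ifP => [T_tree|T_ntree].
      have T_n := spanning_tree_card T_tree.
      by rewrite T_n eqxx (spanning_tree_tau _ T_n) T_tree mul1r.
    by case: eqP => // T_n; rewrite (spanning_tree_tau _ T_n) T_ntree mul0r.
  rewrite multi_polyE; apply: eq_bigr => T _; congr (_ * _); apply: eq_bigr => e _.
  by rewrite /par_at !ffunE -surjective_pairing.
by case: ifP.
Qed.

End Multigraph.

(** Each spanning tree uses exactly one of the two entries at [e]. The cases c = 0 and c nonzero
    provide the hypotheses [h0] and [hZ] on the nonvanishing indicator. *)
Lemma tree_poly_scale n (E : finType) (en : E -> option 'I_n * option 'I_n)
    (K : finFieldType) (z : {ffun E -> K * K}) e (c x y : K) :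
  tree_poly en (upd z e (c * x, c * y)) = c * tree_poly en (upd z e (x, y)).
Proof.
rewrite big_distrr; apply: eq_bigr => T _ /=.
rewrite mulrCA; congr (_ * _); rewrite (bigD1 e) //= ffunE eqxx /=.
rewrite [X in _ = _ * X](bigD1 e) //= ffunE eqxx /= mulrA.
congr (_ * _); first by case: ifP.
by apply: eq_bigr => e' /negPf ne; rewrite !ffunE ne.
Qed.

Lemma tree_poly_affine n (E : finType) (en : E -> option 'I_n * option 'I_n) (K : comNzRingType) (y : E -> K) :
  tree_poly en (fun e => (1, y e)) = \det (lap (edge_row en) y).
Proof.
rewrite det_lap; apply: eq_bigr => T _; rewrite mulrC; congr (_ * _).
by rewrite [RHS]big_mkcond.
Qed.

Section Supported.

Variables (n : nat) (E : finType) (en : E -> option 'I_n * option 'I_n) (D : pred E).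

(* These are the coefficients of sum_affine and sum_deleted. *)
Definition par_weight (e : E) (j : 'I_3) : {poly int} :=
  if D e then match val j with
    0 => 2%:R * 'X - 1 | 1 => 2%:R * ('X - 1) ^+ 2 | _ => - ('X - 1) ^+ 2 end
  else match val j with 0 => 'X | _ => 0 end.

Lemma sum_multigraphs q :
  \sum_(k : {ffun E -> 'I_3}) (\prod_e pval (par_weight e (k e)) q) *
     countY (multigraph en k) q =
  pval (('X * ('X - 1) ^+ 2) ^+ #|E|) q *
  #|[set y : {ffun E -> Fq q} | [forall e, D e || (y e == 0)] &&
     (\det (lap (edge_row en) y) != 0)]|%:R.
Proof.
set K := Fq q; pose N (z : {ffun E -> K * K}) : rat := (tree_poly en z != 0)%:R.
(* [mu e] combines the distributions of [par j] over all pairs, and [nu e] is a multiple of that of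
   (1, t), with t arbitrary or 0 according to [D]. They differ as measures but agree on
   scale-invariant functions vanishing at (0, 0). *)
pose mu e (a : K * K) : rat := \sum_j pval (par_weight e j) q * \sum_(p : K * K) (par j p == a)%:R.
pose C : rat := pval ('X * ('X - 1) ^+ 2) q.
pose nu e (a : K * K) : rat := \sum_(t : K) (C * (D e || (t == 0))%:R) * ((1, t) == a)%:R.
transitivity (\sum_(z : {ffun E -> K * K}) (\prod_e mu e (z e)) * N z).
  under [RHS]eq_bigr => z _ do rewrite bigA_distr_bigA big_distrl /=.
  rewrite exchange_big; apply: eq_bigr => k _ /=.
  under [RHS]eq_bigr => z _ do rewrite big_split -mulrA /=.
  rewrite -big_distrr; congr (_ * _); rewrite countY_multigraph.
  under [LHS]eq_bigr => x _.
    have -> : (tree_poly en (fun e => par (k e) (x e)) != 0)%:R = N [ffun e => par (k e) (x e)] :> rat.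
      congr (nat_of_bool (_ != 0))%:R; apply: eq_bigr => T _; congr (_ * _).
      by apply: eq_bigr => e _; rewrite !ffunE.
    over.
  rewrite [RHS](eq_bigr (fun z : {ffun E -> K * K} => \sum_(x : {ffun E -> K * K})
     (\prod_e (par (k e) (x e) == z e)%:R) * N z)) => [|z _]; last first.
    by rewrite bigA_distr_bigA big_distrl.
  rewrite exchange_big; apply: eq_bigr => x _ /=.
  rewrite (bigD1 [ffun e => par (k e) (x e)]) //= [X in _ + X]big1 => [|z zN].
    by rewrite addr0 big1 ?mul1r // => e _; rewrite ffunE eqxx.
  have [e he] : exists e, par (k e) (x e) != z e.
    apply/existsP; apply: contraNT zN => /existsPn h; apply/eqP/ffunP => e.
    by rewrite ffunE; have := h e; rewrite negbK => /eqP.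
  by rewrite (bigD1 e) //= (negPf he) !mul0r.
have eqN e (z : {ffun E -> K * K}) :
    \sum_a mu e a * N (upd z e a) = \sum_a nu e a * N (upd z e a).
  pose h a := N (upd z e a).
  have h0 : h (0, 0) = 0.
    by have := tree_poly_scale en z e 0 0 0; rewrite !mul0r /h /N => ->; rewrite eqxx.
  have hZ c x y : c != 0 -> h (c * x, c * y) = h (x, y).
    by move=> c0; rewrite /h /N tree_poly_scale mulf_eq0 (negPf c0).
  have pick (X : finType) (f : X -> K * K) : \sum_a (\sum_x (f x == a)%:R) * h a = \sum_x h (f x).
    under eq_bigr => a _ do rewrite big_distrl.
    rewrite exchange_big; apply: eq_bigr => x _ /=.
    rewrite (bigD1 (f x)) //= eqxx mul1r big1 ?addr0 // => a; rewrite eq_sym => /negPf->.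
    by rewrite mul0r.
  have -> : \sum_a mu e a * N (upd z e a) =
      \sum_j pval (par_weight e j) q * \sum_x h (par j x).
    under eq_bigr => a _ do rewrite big_distrl.
    rewrite exchange_big; apply: eq_bigr => j _ /=; rewrite -pick mulr_sumr.
    by apply: eq_bigr => a _; rewrite [RHS]mulrA.
  have -> : \sum_a nu e a * N (upd z e a) = C * \sum_t (D e || (t == 0))%:R * h (1, t).
    under eq_bigr => a _ do rewrite big_distrl.
    rewrite exchange_big big_distrr; apply: eq_bigr => t _ /=.
    rewrite (bigD1 (1, t)) //= eqxx mulr1 big1 ?addr0 ?mulrA // => a.
    by rewrite eq_sym => /negPf->; rewrite mulr0 mul0r.
  have qE : #|K|%:R = (q : nat)%:R :> rat by rewrite card_Fq.
  rewrite !big_ord_recl big_ord0 /= /par_weight /C.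
  have -> : lift ord0 (ord0 : 'I_2) = 1 :> 'I_3 by apply: val_inj.
  have -> : lift ord0 (lift ord0 (ord0 : 'I_1)) = 2%:R :> 'I_3 by apply: val_inj.
  case: ifP => De /=.
    under [X in _ = _ * X]eq_bigr => t _ do rewrite mul1r.
    by rewrite !pvalE -qE (sum_affine h0 hZ); ring.
  rewrite (bigD1 0) //= eqxx mul1r [X in _ * (_ + X)]big1 => [|t /negPf->]; last by rewrite mul0r.
  by rewrite !pvalE -qE !addr0 ?mul1r (sum_deleted h0 hZ); ring.
rewrite (eq_sum_prod_weights eqN) -(sum_ffun_comp (fun t => (1, t)) _ N).
rewrite -sum1_card natr_sum [in RHS]big_mkcond pval_exp [RHS]mulr_sumr.
apply: eq_bigr => y _.
rewrite big_split /= prodr_const -mulrA; congr (_ * _); rewrite inE.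
have -> : N [ffun e => (1, y e)] = (\det (lap (edge_row en) y) != 0)%:R.
  rewrite -tree_poly_affine; congr (nat_of_bool (_ != 0))%:R.
  apply: eq_bigr => T _; congr (_ * _); by apply: eq_bigr => e _; rewrite !ffunE.
have [/forallP Dy|/forallPn[e De]] := boolP [forall e, D e || (y e == 0)].
  rewrite big1 => [|e _]; last by rewrite Dy.
  by rewrite mul1r /=; case: ifP.
by rewrite (bigD1 e) //= (negPf De) !mul0r.
Qed.

Lemma Graphs_supported :
  Graphs (fun q => #|[set y : {ffun E -> Fq q} | [forall e, D e || (y e == 0)] &&
     (\det (lap (edge_row en) y) != 0)]|%:R).
Proof.
apply: (Graphs_div (satS_exp #|E| (satS_mul satSX (satS_exp 2 satSXB1)))) => [|q].
  apply: (Graphs_sum (I := {ffun E -> 'I_3})) => k; apply: GraphsZ.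
    exact: (locR_prod (fun e => locR_poly (par_weight e (k e)))).
  by apply: span_gen; exists (multigraph en k).
by rewrite -sum_multigraphs.
Qed.

End Supported.

(** * Invertible symmetric matrices with prescribed zeros *)

Definition sym_pattern (n : nat) (H : rel 'I_n) (K : finFieldType) (M : 'M[K]_n) : bool :=
  (M^T == M) && [forall i, forall j, (i != j) && ~~ H i j ==> (M i j == 0)].

Lemma sym_patternP n (H : rel 'I_n) (K : finFieldType) (M : 'M[K]_n) :
  reflect (M^T = M /\ forall i j, i != j -> ~~ H i j -> M i j = 0) (sym_pattern H M).
Proof.
apply: (iffP andP) => [[/eqP MT /forallP h]|[MT h]]; split=> //.
- by move=> i j ij Hij; apply/eqP; move: (forallP (h i) j); rewrite ij Hij.
- by apply/eqP.
- by apply/forallP => i; apply/forallP => j; apply/implyP => /andP[ij Hij]; rewrite h.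
Qed.

Section CompleteGraph.

Variables (n : nat) (H : rel 'I_n).

(* A pair (i, i) is the edge from i to the root None; the pairs (i, j) with
   j < i are junk loops, never kept by pattern_edge. *)
Definition complete_ends (e : 'I_n * 'I_n) : option 'I_n * option 'I_n :=
  if e.1 == e.2 then (None, Some e.2)
  else if (e.1 < e.2)%N then (Some e.1, Some e.2) else (None, None).

Definition pattern_edge (e : 'I_n * 'I_n) : bool :=
  (e.1 == e.2) || [&& (e.1 < e.2)%N, H e.1 e.2 & H e.2 e.1].

Local Notation row := (edge_row complete_ends).

Lemma edge_row_diag i k : row (i, i) k = (i == k)%:R.
Proof. by rewrite /edge_row /complete_ends /= eqxx subr0 (inj_eq (@Some_inj _)). Qed.

Lemma edge_row_lt (i j : 'I_n) k : (i < j)%N -> row (i, j) k = (j == k)%:R - (i == k)%:R.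
Proof.
move=> ij; have nij : (i == j) = false by apply/eqP => ij'; rewrite ij' ltnn in ij.
by rewrite /edge_row /complete_ends /= ij nij !(inj_eq (@Some_inj _)).
Qed.

Lemma edge_row_gt (i j : 'I_n) k : (j < i)%N -> row (i, j) k = 0.
Proof.
move=> ji; have nij : (i == j) = false by apply/eqP => ij'; rewrite ij' ltnn in ji.
by rewrite /edge_row /complete_ends /= nij ltnNge (ltnW ji) /= subrr.
Qed.

Lemma edge_row_sum e : \sum_k row e k = (e.1 == e.2)%:R.
Proof.
have sum1 (w : 'I_n) : \sum_k (w == k)%:R = 1 :> int.
  by rewrite (bigD1 w) //= eqxx big1 ?addr0 // => k; rewrite eq_sym => /negPf->.
case: e => i j; case: (ltngtP i j) => [ij|ji|/val_inj <-] /=.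
- rewrite (eq_bigr _ (fun k _ => edge_row_lt k ij)) sumrB !sum1 subrr.
  by case: eqP => // e; rewrite e ltnn in ij.
- rewrite big1 => [|k _]; last exact: edge_row_gt.
  by case: eqP => // e; rewrite e ltnn in ji.
- by rewrite (eq_bigr _ (fun k _ => edge_row_diag i k)) sum1 eqxx.
Qed.

Variable K : finFieldType.

Lemma lap_complete_off (y : 'I_n * 'I_n -> K) (a b : 'I_n) :
  (a < b)%N -> lap row y a b = - y (a, b).
Proof.
move=> ab; have nab : (a == b) = false by apply/eqP => e; rewrite e ltnn in ab.
rewrite mxE (bigD1 (a, b)) //= !edge_row_lt // !eqxx nab eq_sym nab.
rewrite sub0r subr0 mulr1 rmorphN1 mulrN1 big1 ?addr0 // => -[i j] ne.
suff -> : row (i, j) a * row (i, j) b = 0 by rewrite mulr0.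
case: (ltngtP i j) => [ij|ji|/val_inj ij].
- rewrite !edge_row_lt //.
  have [/eqP ia|ia] := boolP (i == a); have [/eqP jb|jb] := boolP (j == b).
  + by rewrite ia jb eqxx in ne.
  + by rewrite -ia in nab *; rewrite nab subrr mulr0.
  + by rewrite jb [b == a]eq_sym nab subrr mul0r.
  + have [/eqP ja|ja] := boolP (j == a); last by rewrite subrr mul0r.
    have [/eqP ib|ib] := boolP (i == b); last by rewrite subrr mulr0.
    by rewrite ja ib ltnNge (ltnW ab) in ij.
- by rewrite edge_row_gt // mul0r.
- rewrite ij !edge_row_diag; case: eqP => [->|_]; last by rewrite mul0r.
  by rewrite nab mulr0.
Qed.

Lemma lap_sym (E : finType) (b : E -> 'I_n -> int) (y : E -> K) : (lap b y)^T = lap b y.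
Proof.
by apply/matrixP => i j; rewrite !mxE; apply: eq_bigr => e _; rewrite [b e j * _]mulrC.
Qed.

(** An edge avoiding the root contributes 0 to a row sum, so only the edge from a to the root
    remains. *)
Lemma lap_complete_diag (y : 'I_n * 'I_n -> K) (a : 'I_n) :
  \sum_b lap row y a b = y (a, a).
Proof.
under eq_bigr => b _ do rewrite mxE.
rewrite exchange_big /= (eq_bigr (fun e => y e * (row e a * (e.1 == e.2)%:R)%:~R)).
  rewrite (bigD1 (a, a)) //= edge_row_diag !eqxx mulr1z mulr1 big1 ?addr0 // => -[i j] /= ne.
  case: eqP => [e|_]; last by rewrite mulr0 mulr0z mulr0.
  rewrite -e edge_row_diag; case: eqP => [ia|_]; last by rewrite mul0r mulr0z mulr0.
  by rewrite -e ia eqxx in ne.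
move=> e _; rewrite -edge_row_sum -big_distrr /= -rmorph_sum; congr (_ * _%:~R).
by rewrite big_distrr.
Qed.

(** The weights are recovered from the matrix: those of ordinary edges are the opposites of the
    off-diagonal entries, those of the root edges are the row sums. All root edges being kept, the
    diagonal is unconstrained. *)
Lemma card_sym_pattern :
  #|[set y : {ffun 'I_n * 'I_n -> K} | [forall e, pattern_edge e || (y e == 0)] &&
      (\det (lap row y) != 0)]| =
  #|[set M : 'M[K]_n | sym_pattern H M && (\det M != 0)]|.
Proof.
pose g (M : 'M[K]_n) : {ffun 'I_n * 'I_n -> K} := [ffun e =>
  if e.1 == e.2 then \sum_b M e.1 b else if (e.1 < e.2)%N then - M e.1 e.2 else 0].
pose f (y : {ffun 'I_n * 'I_n -> K}) := lap row y.
have fT y i j : f y i j = f y j i by rewrite /f -{1}(lap_sym row) [LHS]mxE.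
have lt_neq (i j : 'I_n) : (i < j)%N -> (i == j) = false.
  by move=> ij; apply/eqP => e; rewrite e ltnn in ij.
have fK (y : {ffun 'I_n * 'I_n -> K}) : [forall e, pattern_edge e || (y e == 0)] ->
    g (f y) = y.
  move=> /forallP sy; apply/ffunP => -[i j]; rewrite ffunE /=.
  case: (ltngtP i j) => [ij|ji|/val_inj <-].
  - by rewrite lt_neq // lap_complete_off // opprK.
  - rewrite eq_sym lt_neq //; have := sy (i, j).
    by rewrite /pattern_edge /= eq_sym lt_neq //= ltnNge (ltnW ji) /= => /eqP.
  - by rewrite eqxx lap_complete_diag.
have gK (M : 'M[K]_n) : M^T = M -> f (g M) = M.
  move=> MT; have MTE i j : M i j = M j i by rewrite -{1}MT mxE.
  have off (a b : 'I_n) : (a < b)%N -> f (g M) a b = M a b.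
    by move=> ab; rewrite lap_complete_off // ffunE /= lt_neq // ab opprK.
  have off' (a b : 'I_n) : a != b -> f (g M) a b = M a b.
    case: (ltngtP a b) => [ab|ba|/val_inj->]; rewrite ?eqxx // => _; first exact: off.
    by rewrite fT MTE off.
  apply/matrixP => a b; have [<-|ab] := eqVneq a b; last exact: off'.
  have := lap_complete_diag (g M) a; rewrite ffunE /= eqxx.
  rewrite (bigD1 a) //= [in RHS](bigD1 a) //=.
  rewrite (eq_bigr (M a)) => [/addIr//|c ca].
  by rewrite -off' // eq_sym.
rewrite -!sum1_card [in RHS](reindex_onto f g) /=; last first.
  by move=> M; rewrite inE => /andP[/sym_patternP[MT _] _]; apply: gK.
apply: eq_bigl => y; rewrite !inE.
have [sy|sy] := boolP [forall e, pattern_edge e || (y e == 0)] => /=.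
  rewrite fK // eqxx andbT andb_idl // => _; apply/sym_patternP; split; first exact: lap_sym.
  have off (i j : 'I_n) : (i < j)%N -> ~~ H i j || ~~ H j i -> f y i j = 0.
    move=> ij Hij; rewrite lap_complete_off //.
    move: (forallP sy (i, j)); rewrite /pattern_edge /= lt_neq // ij /= -[_ && _]negbK negb_and Hij /=.
    by move=> /eqP->; rewrite oppr0.
  move=> i j; case: (ltngtP i j) => [ij|ji|/val_inj->]; rewrite ?eqxx // => _ Hij.
    by rewrite off // Hij.
  by rewrite fT off // Hij orbT.
apply/esym/negP => /andP[/andP[/sym_patternP[_ h] _] /eqP e]; case/negP: sy; rewrite -e.
apply/forallP => -[i j]; rewrite /pattern_edge ffunE /=.
have [ij|ij] := eqVneq i j => //=; case: ltnP => //= lt_ij; rewrite ?eqxx ?orbT //.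
have [Hij|Hij] := boolP (H i j); last by rewrite h ?oppr0 ?eqxx.
have [Hji|Hji] := boolP (H j i) => //=.
by rewrite fT h ?oppr0 // eq_sym.
Qed.

End CompleteGraph.

Lemma Graphs_sym_invertible n (H : rel 'I_n) :
  Graphs (fun q => #|[set M : 'M[Fq q]_n | sym_pattern H M && (\det M != 0)]|%:R).
Proof.
apply: span_ext (Graphs_supported (@complete_ends n) (pattern_edge H)) => q.
by rewrite card_sym_pattern.
Qed.

(** * Ranks of bordered symmetric matrices *)

Lemma mxrank_col_row (F : fieldType) m n (v : 'rV[F]_n) (A : 'M[F]_(m, n)) :
  \rank (col_mx v A) = (~~ (v <= A)%MS + \rank A)%N.
Proof.
rewrite -addsmxE; have [vA|vA] := boolP (v <= A)%MS; first by rewrite (addsmx_idPr vA).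
have v0 : v != 0 by apply: contraNneq vA => ->; exact: sub0mx.
have := mxrank_sum_cap v A; rewrite rank_rV v0.
suff -> : \rank (v :&: A)%MS = 0%N by rewrite addn0.
have : (\rank (v :&: A) < \rank v)%N.
  rewrite ltn_neqAle mxrankS ?capmxSl // andbT.
  by rewrite (mxrank_leqif_sup (capmxSl v A)) sub_capmx submx_refl.
by rewrite rank_rV v0 ltnS leqn0 => /eqP.
Qed.

Lemma card_submx_row (K : finFieldType) m n (A : 'M[K]_(m, n)) :
  #|[set v : 'rV[K]_n | (v <= A)%MS]| = (#|K| ^ \rank A)%N.
Proof.
rewrite -(card_rowg A); apply: eq_card => v.
by rewrite !inE.
Qed.

Section Border.

Variables (n : nat) (K : finFieldType) (X : 'M[K]_n).
Hypothesis XT : X^T = X.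

Definition border (z : K) (y : 'rV[K]_n) : 'M[K]_(1 + n) := block_mx z%:M y y^T X.

(** Completing the square: the congruence by [P] clears the border and leaves the Schur complement z
    - a X a^T beside X. *)
Lemma rank_border_in z (a : 'rV[K]_n) :
  \rank (border z (a *m X)) = ((z != (a *m X *m a^T) ord0 ord0) + \rank X)%N.
Proof.
pose P : 'M[K]_(1 + n) := block_mx 1 (- a) 0 1%:M.
have P_unit : P \in unitmx by rewrite unitmxE det_ublock !det1 mulr1 unitr1.
have PMP : P *m border z (a *m X) *m P^T =
    block_mx (z%:M - a *m X *m a^T) 0 0 X.
  rewrite /P /border tr_block_mx !mulmx_block trmx_mul XT !trmx1 trmx0 linearN /=.
  rewrite !(mul1mx, mul0mx, add0r, mulmx1, mulmx0, addr0, mulNmx, mulmxN, mulmxA).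
  by rewrite !(subrr, mul0mx, oppr0, addr0).
transitivity (\rank (P *m border z (a *m X) *m P^T)).
  rewrite mxrankMfree ?row_free_unit ?unitmx_tr //.
  by rewrite -[RHS]mxrank_tr trmx_mul mxrankMfree ?row_free_unit ?unitmx_tr // mxrank_tr.
rewrite PMP rank_diag_block_mx; congr (_ + _)%N.
rewrite rank_rV; congr (nat_of_bool (~~ _)).
rewrite subr_eq0; apply/eqP/eqP => [e|->].
  by move/matrixP: e => /(_ ord0 ord0); rewrite mxE mulr1n.
by rewrite [RHS]mx11_scalar.
Qed.

(** By symmetry the new column raises the rank by one; the new row raises it again, since its last n
    entries are already outside the row space of X, whatever z is. *)
Lemma rank_border_out z (y : 'rV[K]_n) : ~~ (y <= X)%MS ->
  \rank (border z y) = (2 + \rank X)%N.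
Proof.
move=> yX; rewrite /border /block_mx mxrank_col_row.
have -> : \rank (row_mx y^T X) = (1 + \rank X)%N.
  by rewrite -mxrank_tr tr_row_mx trmxK XT mxrank_col_row yX.
suff -> : (row_mx z%:M y <= row_mx y^T X)%MS = false by [].
apply/negP => /submxP[D]; rewrite mul_mx_row => /eq_row_mx[_ yE].
by case/negP: yX; rewrite yE submxMl.
Qed.

Local Notation q := #|K|.

(** The terms correspond to y in the row space with the one exceptional z, y in the row space with
    any other z, and y outside it: the rank grows by 0, 1 and 2. *)
Lemma card_border d :
  #|[set zy : K * 'rV[K]_n | (\rank (border zy.1 zy.2) + d == 1 + n)%N]| =
  (q ^ \rank X * (\rank X + d == 1 + n) + q ^ \rank X * q.-1 * (\rank X + d == n)
   + (q ^ n - q ^ \rank X) * q * (\rank X + d.+1 == n))%N.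
Proof.
rewrite -sum1_card big_mkcond big_pair exchange_big /=.
have inE' y : (y <= X)%MS -> (\sum_z (if (z, y) \in
    [set zy : K * 'rV[K]_n | (\rank (border zy.1 zy.2) + d == 1 + n)%N] then 1 else 0) =
    (\rank X + d == 1 + n) + q.-1 * (\rank X + d == n))%N.
  move=> /submxP[a ->]; pose z0 := (a *m X *m a^T) ord0 ord0.
  rewrite (bigD1 z0) //= inE /= rank_border_in eqxx add0n; congr (_ + _)%N.
  rewrite -(cardC1 z0) -sum1_card big_distrl /=; apply: eq_big => // z zz0.
  by rewrite inE /= rank_border_in zz0 mul1n -addnA eqn_add2l.
have outE y : ~~ (y <= X)%MS -> (\sum_z (if (z, y) \in
    [set zy : K * 'rV[K]_n | (\rank (border zy.1 zy.2) + d == 1 + n)%N] then 1 else 0) =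
    q * (\rank X + d.+1 == n))%N.
  move=> yX; rewrite -sum1_card big_distrl /=; apply: eq_bigr => z _.
  rewrite inE /= rank_border_out // mul1n.
  by have -> : (2 + \rank X + d == 1 + n)%N = (\rank X + d.+1 == n)%N by lia.
rewrite (bigID (fun y => (y <= X)%MS)) /=.
rewrite (eq_bigr _ inE') [X in (_ + X)%N](eq_bigr _ outE) !sum_nat_const.
have -> : #|[pred y : 'rV[K]_n | (y <= X)%MS]| = (q ^ \rank X)%N.
  by rewrite -card_submx_row; apply: eq_card => v; rewrite !inE.
have -> : #|[pred y : 'rV[K]_n | ~~ (y <= X)%MS]| = (q ^ n - q ^ \rank X)%N.
  have := cardsC [set v : 'rV[K]_n | (v <= X)%MS].
  rewrite card_submx_row card_mx mul1n => <-; rewrite addKn.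
  by apply: eq_card => v; rewrite !inE.
by rewrite mulnDr !mulnA.
Qed.

End Border.

Definition free_border n (H : rel 'I_n) : rel 'I_(1 + n) :=
  fun i j => match split i, split j with inr i', inr j' => H i' j' | _, _ => true end.

Lemma sym_pattern_border n (H : rel 'I_n) (K : finFieldType) (X : 'M[K]_n) z y :
  sym_pattern (free_border H) (border X z y) = sym_pattern H X.
Proof.
apply/sym_patternP/sym_patternP => -[].
  rewrite /border tr_block_mx => /eq_block_mx[_ _ _ XT] h; split=> // i j ij Hij.
  have := h (rshift 1 i) (rshift 1 j); rewrite /border block_mxEdr; apply.
    by rewrite (inj_eq (@rshift_inj _ _)).
  by rewrite /free_border !(unsplitK (inr _)).
move=> XT h; split; first by rewrite /border tr_block_mx XT trmxK tr_scalar_mx.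
move=> i j; rewrite /free_border /border.
case: (split_ordP i) => [i' ->|i' ->]; case: (split_ordP j) => [j' ->|j' ->] //.
rewrite block_mxEdr (inj_eq (@rshift_inj _ _)); exact: h.
Qed.

Definition sym_corank n (H : rel 'I_n) (d : nat) (K : finFieldType) : nat :=
  #|[set M : 'M[K]_n | sym_pattern H M && (\rank M + d == n)%N]|.

Lemma sym_corank_border n (H : rel 'I_n) d (K : finFieldType) :
  sym_corank (free_border H) d K =
  (\sum_(X : 'M[K]_n | sym_pattern H X) (#|K| ^ \rank X * (\rank X + d == 1 + n) +
     #|K| ^ \rank X * #|K|.-1 * (\rank X + d == n) +
     (#|K| ^ n - #|K| ^ \rank X) * #|K| * (\rank X + d.+1 == n)))%N.
Proof.
pose f (p : 'M[K]_n * (K * 'rV[K]_n)) := border p.1 p.2.1 p.2.2.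
pose g (M : 'M[K]_(1 + n)) := (drsubmx M, (ulsubmx M ord0 ord0, ursubmx M)).
have fK p : g (f p) = p.
  case: p => X [z y]; rewrite /f /g /border /= block_mxKdr block_mxKul block_mxKur.
  by rewrite mxE eqxx mulr1n.
rewrite /sym_corank -sum1_card (reindex_onto f g) /=; last first.
  move=> M; rewrite inE => /andP[/sym_patternP[MT _] _].
  rewrite -[RHS]submxK /f /g /border /=; congr block_mx.
    by rewrite -mx11_scalar.
  by rewrite trmx_ursub MT.
rewrite (eq_bigl (fun p => sym_pattern H p.1 && (\rank (f p) + d == 1 + n)%N)) => [|p]; last first.
  by rewrite inE fK eqxx andbT sym_pattern_border.
rewrite big_mkcond big_pair /= [RHS]big_mkcond; apply: eq_bigr => X _.
case: ifP => [/sym_patternP[XT _]|_]; last by rewrite big1.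
rewrite -card_border // -sum1_card [RHS]big_mkcond; apply: eq_bigr => zy _.
by rewrite inE.
Qed.

(* Bordering by a free row takes corank d + 1 to coranks d, d + 1 and d + 2, so
   the counts of corank at most d, for all H, determine that of corank d + 1. *)
Lemma Graphs_sym_corank n (H : rel 'I_n) d :
  Graphs (fun q => (sym_corank H d (Fq q))%:R).
Proof.
elim/ltn_ind: d n H => -[_|d IH] n H.
  apply: span_ext (Graphs_sym_invertible H) => q; congr (_%:R); apply: eq_card => M.
  rewrite !inE addn0 -[RHS]/(sym_pattern H M && row_free M).
  by rewrite row_free_unit unitmxE unitfE.
have [dn|nd] := ltnP d n; last first.
  apply: span_ext (span_zero _ _) => q; rewrite /sym_corank (_ : [set _ | _] = set0) ?cards0 //.
  apply/setP => M; rewrite !inE; case: eqP => [e|_]; last by rewrite andbF.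
  exfalso; lia.
(* Corank d - 1; for d = 0 no matrix qualifies, hence the value 0. *)
pose lower : prime_power -> rat := fun q => if d is d'.+1 then (sym_corank H d' (Fq q))%:R else 0.
have lowerG : Graphs lower.
  case: {dn} d @lower IH => [|d'] lower IH; first exact: span_zero.
  by apply: IH; lia.
(* This is (q^n - q^r) q at r = n - d - 1, the number of borders that take corank d + 1 to corank d.
   The two coefficients subtracted below come from r = n - d + 1 and r = n - d. *)
pose s : {poly int} := 'X^(n - d.+1) * ('X^(d.+1) - 1) * 'X.
have sS : satS s by apply: satS_mul satSX; apply: satS_mul (satSXn _) (satSXnB1 _).
apply: (Graphs_div sS (g := fun q => (sym_corank (free_border H) d (Fq q))%:R
   - pval 'X^((n - d).+1) q * lower q
   - pval ('X^(n - d) * ('X - 1)) q * (sym_corank H d (Fq q))%:R)) => [|q].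
  by apply: GraphsB; [apply: GraphsB |]; rewrite -?/(lower _); [apply: IH| apply: GraphsZp | apply: GraphsZp; apply: IH].
rewrite sym_corank_border; set K := Fq q.
have qE : #|K| = q :> nat by rewrite card_Fq.
have q1 : (#|K|.-1)%:R = q%:R - 1 :> rat.
  by rewrite -qE -subn1 natrB // qE ltnW // pp_gt1.
have cE d' : (sym_corank H d' K)%:R =
    \sum_(X : 'M[K]_n | sym_pattern H X) ((\rank X + d' == n)%N)%:R :> rat.
  rewrite /sym_corank -sum1_card natr_sum (eq_bigl _ _ (in_set _)) big_mkcondr.
  by apply: eq_bigr => X _; case: eqP.
have lE : lower q = \sum_(X : 'M[K]_n | sym_pattern H X) ((\rank X + d == 1 + n)%N)%:R.
  rewrite /lower; case: (d) dn => [|d'] dn; last by rewrite cE; apply: eq_bigr => X _; rewrite addnS add1n.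
  rewrite big1 // => X _; case: eqP => // e; have := rank_leq_row X; lia.
rewrite lE !cE natr_sum !mulr_sumr -!sumrB; apply: eq_bigr => X _.
rewrite !natrD !natrM !pvalE q1 qE natrB; last first.
  by rewrite leq_pexp2l ?rank_leq_row // ltnW // pp_gt1.
move: (pp_val q) (\rank X) => Q r; rewrite !natrX.
have [e|ne] := altP (r + d.+1 =P n)%N.
  have -> : (r + d == 1 + n)%N = false by lia.
  have -> : (r + d == n)%N = false by lia.
  by rewrite -e addnK exprD /= mulr0n mulr1n; ring.
have [e1|ne1] := altP (r + d =P n)%N.
  have -> : (r + d == 1 + n)%N = false by lia.
  by rewrite -e1 addnK /= mulr0n mulr1n; ring.
have [e2|ne2] := altP (r + d =P 1 + n)%N; last by rewrite /= mulr0n; ring.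
have -> : (n - d).+1 = r by lia.
by rewrite /= mulr0n mulr1n; ring.
Qed.

(** * Point-line configurations *)

(** Requiring an entry to be nonzero is the difference between no requirement and requiring it to be
    0, which is again a pattern. Patterns do not see the diagonal, so S must avoid it. *)
Lemma Graphs_sym_rank_seq n (H : rel 'I_n) r (S : seq ('I_n * 'I_n)) :
  all (fun p => p.1 != p.2) S ->
  Graphs (fun q => #|[set M : 'M[Fq q]_n | [&& sym_pattern H M, \rank M == r &
    all (fun p => M p.1 p.2 != 0) S]]|%:R).
Proof.
elim: S H => [|[i j] S IH] H /=.
  move=> _; have [rn|nr] := leqP r n.
    apply: span_ext (Graphs_sym_corank H (n - r)) => q; congr (_%:R).
    apply: eq_card => M; rewrite !inE andbT; congr (_ && _).
    by apply/eqP/eqP; lia.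
  apply: span_ext (span_zero _ _) => q.
  rewrite (_ : [set _ | _] = set0) ?cards0 //; apply/setP => M; rewrite !inE.
  by case: eqP => [e|_]; [have := rank_leq_row M; lia | rewrite andbF].
case/andP => ij Sij.
pose H' : rel 'I_n := fun a b => H a b && ((a, b) \notin [:: (i, j); (j, i)]).
apply: span_ext (GraphsB (IH H Sij) (IH H' Sij)) => q.
rewrite -natrB; last first.
  apply/subset_leq_card/subsetP => M; rewrite !inE => /and3P[/sym_patternP[MT h] -> ->].
  rewrite !andbT; apply/sym_patternP; split=> // a b ab Hab; apply: h => //.
  by rewrite /H' negb_and Hab.
congr (_%:R).
set A := [set M | _]; set B := [set M | _].
have <- : A :\: B = [set M : 'M[Fq q]_n | [&& sym_pattern H M, \rank M == r,
    M i j != 0 & all (fun p => M p.1 p.2 != 0) S]].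
  apply/setP => M; rewrite !inE.
  have -> : sym_pattern H' M = sym_pattern H M && (M i j == 0).
    apply/sym_patternP/andP => [[MT h]|[/sym_patternP[MT h] /eqP Mij]].
      split; last by rewrite h // /H' !inE eqxx andbF.
      apply/sym_patternP; split=> // a b ab Hab; apply: h => //.
      by rewrite /H' negb_and Hab.
    split=> // a b ab; rewrite /H' negb_and negbK !inE => /orP[|/orP[]/eqP[-> ->]] //.
      exact: h.
    by rewrite -MT mxE.
  by case: (sym_pattern H M); case: (\rank M == r);
    case: (all (fun p => M p.1 p.2 != 0) S); rewrite /= ?andbT ?andbF.
rewrite cardsD; congr (_ - #|pred_of_set _|)%N.
apply/esym/setIidPr/subsetP => M; rewrite !inE => /and3P[/sym_patternP[MT h] -> ->].
rewrite !andbT; apply/sym_patternP; split=> // a b ab Hab; apply: h => //.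
by rewrite /H' negb_and Hab.
Qed.

Lemma Graphs_sym_rank_nonzero n (H : rel 'I_n) r (S : rel 'I_n) :
  irreflexive S ->
  Graphs (fun q => #|[set M : 'M[Fq q]_n | [&& sym_pattern H M, \rank M == r &
    [forall i, forall j, S i j ==> (M i j != 0)]]]|%:R).
Proof.
move=> Sirr; pose s := [seq p <- enum {: 'I_n * 'I_n} | S p.1 p.2].
have sP : all (fun p => p.1 != p.2) s.
  by apply/allP => -[i j]; rewrite mem_filter => /andP[Sij _]; apply: contraTneq Sij => /= ->; rewrite Sirr.
apply: span_ext (Graphs_sym_rank_seq H r sP) => q; congr (_%:R); apply: eq_card => M.
rewrite !inE; congr [&& _, _ & _]; apply/allP/forallP => [h i|h [i j]].
  by apply/forallP => j; apply/implyP => Sij; apply: (h (i, j)); rewrite mem_filter Sij mem_enum.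
by rewrite mem_filter => /andP[Sij _]; apply: (implyP (forallP (h i) j)).
Qed.

(** The columns g have rank r, so by symmetry the rows g span the row space: M = Z U^T, and U = Z D
    for the diagonal block D. The block at rows f and columns g then factors through D and forces D
    to be invertible, although its diagonal entries cannot be prescribed. *)
Lemma sym_rank_decomposition (F : fieldType) N r (M : 'M[F]_N) (f g : 'I_r -> 'I_N) :
  M^T = M -> \rank M = r -> mxsub f g M \in unitmx ->
  mxsub g g M \in unitmx /\
  M = colsub g M *m invmx (mxsub g g M) *m (colsub g M)^T.
Proof.
move=> MT Mr fg_unit; set U := colsub g M; set D := mxsub g g M.
have UT : U^T = rowsub g M by rewrite trmx_mxsub MT.
have rkU : \rank U^T = r.
  apply/eqP; rewrite eqn_leq rank_leq_row /= mxrank_tr -{1}(mxrank_unit fg_unit).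
  have -> : mxsub f g M = rowsub f U by apply/matrixP => i j; rewrite !mxE.
  by rewrite mxrankS // rowsub_sub.
have /submxP[Z MZ] : (M <= U^T)%MS.
  have UM : (U^T <= M)%MS by rewrite UT rowsub_sub.
  by rewrite -(mxrank_leqif_sup UM) rkU Mr.
have UZ : U = Z *m D.
  apply/matrixP => i k; rewrite mxE MZ !mxE; apply: eq_bigr => l _.
  by rewrite !mxE -{1}MT mxE.
have D_unit : D \in unitmx.
  move: fg_unit; have -> : mxsub f g M = rowsub f Z *m D.
    by rewrite mul_rowsub_mx -UZ; apply/matrixP => i j; rewrite !mxE.
  by rewrite unitmx_mul => /andP[].
by split=> //; have -> : U *m invmx D = Z by rewrite UZ mulmxK.
Qed.

Definition fits (p : option bool) (R : nzRingType) (x : R) : bool :=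
  if p is Some b then (x != 0) == b else true.

Lemma card_ffun_neq0 (T : finType) (K : finFieldType) :
  #|[set c : {ffun T -> K} | [forall k, c k != 0]]| = (#|K|.-1 ^ #|T|)%N.
Proof.
rewrite -(cardC1 (0 : K)) -card_ffun_on; apply: eq_card => c.
by rewrite inE; apply/forallP/ffun_onP.
Qed.

Section Configurations.

Variables (r : nat) (A B : finType).
Variables (pa : A -> 'I_r -> option bool) (pb : B -> 'I_r -> option bool) (rho : A -> B -> bool).

Definition configuration (K : finFieldType)
    (ab : {ffun A * 'I_r -> K} * {ffun B * 'I_r -> K}) : bool :=
  [&& [forall i, forall k, fits (pa i k) (ab.1 (i, k))],
      [forall j, forall k, fits (pb j k) (ab.2 (j, k))] &
      [forall i, forall j, rho i j ==> (\sum_k ab.1 (i, k) * ab.2 (j, k) == 0)]].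

(* The rows iP and the columns iL of a symmetric matrix of rank r carry an
   invertible diagonal block; the vectors indexed by A and B are then read off
   the columns iL, by sym_rank_decomposition. *)
Let W : finType := ('I_r + ('I_r + (A + B)))%type.
Local Notation iP k := (inl k : W).
Local Notation iL k := (inr (inl k) : W).
Local Notation iA i := (inr (inr (inl i)) : W).
Local Notation iB j := (inr (inr (inr j)) : W).

(** The default pairs are determined by the columns [iL] through the rank condition. Excluding all
    pairs inside [iL] makes that block diagonal, as a pattern never restricts diagonal entries. *)
Let free (v w : W) : bool :=
  match v, w with
  | inl k, inr (inl l) | inr (inl l), inl k => k == l
  | inr (inl _), inr (inl _) => false
  | inr (inr (inl i)), inr (inl k) | inr (inl k), inr (inr (inl i)) => pa i k != Some false
  | inr (inr (inr j)), inr (inl k) | inr (inl k), inr (inr (inr j)) => pb j k != Some false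
  | inr (inr (inl i)), inr (inr (inr j)) | inr (inr (inr j)), inr (inr (inl i)) => ~~ rho i j
  | _, _ => true
  end.

Let nonzero (v w : W) : bool :=
  match v, w with
  | inl k, inr (inl l) => k == l
  | inr (inr (inl i)), inr (inl k) => pa i k == Some true
  | inr (inr (inr j)), inr (inl k) => pb j k == Some true
  | _, _ => false
  end.

Local Notation N := #|W|.
Let pos (w : W) : 'I_N := enum_rank w.

Let H : rel 'I_N := fun i j => free (enum_val i) (enum_val j).
Let S : rel 'I_N := fun i j => nonzero (enum_val i) (enum_val j).

Let half_pair (v w : W) : bool :=
  match v, w with
  | inl _, inr (inl _) | inr (inl _), inr (inl _) | inr (inr _), inr (inl _) => true
  | inr (inr (inl _)), inr (inr (inr _)) => true
  | _, _ => false
  end.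

Let freeC v w : free v w = free w v.
Proof. by case: v w => [k|[k|[i|j]]] [l|[l|[i'|j']]] //=; rewrite eq_sym. Qed.

Let S_irr : irreflexive S.
Proof. by move=> i; rewrite /S; case: (enum_val i) => // -[|[]]. Qed.

Section Field.

Variable K : finFieldType.

Let good (M : 'M[K]_N) : bool :=
  [&& sym_pattern H M, \rank M == r & [forall i, forall j, S i j ==> (M i j != 0)]].

(** These are the columns [iL] of the matrix; [cd] holds the diagonals of the blocks [iP]-[iL] and
    [iL]-[iL]. The vectors of B are scaled by the latter because [mat] divides by it, so that an
    entry between A and B is a plain scalar product. *)
Let entries (cd : {ffun 'I_r -> K} * {ffun 'I_r -> K})
    (ab : {ffun A * 'I_r -> K} * {ffun B * 'I_r -> K}) (w : W) (k : 'I_r) : K :=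
  match w with
  | inl l => (l == k)%:R * cd.1 k
  | inr (inl l) => (l == k)%:R * cd.2 k
  | inr (inr (inl i)) => ab.1 (i, k)
  | inr (inr (inr j)) => ab.2 (j, k) * cd.2 k
  end.

Let mat cd ab : 'M[K]_N :=
  \matrix_(i, j) \sum_k entries cd ab (enum_val i) k * (cd.2 k)^-1 * entries cd ab (enum_val j) k.

Let units (cd : {ffun 'I_r -> K} * {ffun 'I_r -> K}) : bool :=
  [forall k, cd.1 k != 0] && [forall k, cd.2 k != 0].

Let mat_pos cd ab v w : mat cd ab (pos v) (pos w) =
  \sum_k entries cd ab v k * (cd.2 k)^-1 * entries cd ab w k.
Proof. by rewrite mxE !enum_rankK. Qed.

Let mat_L cd ab v l : units cd -> mat cd ab (pos v) (pos (iL l)) = entries cd ab v l.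
Proof.
move=> /andP[_ /forallP d0]; rewrite mat_pos (bigD1 l) //= eqxx mul1r divfK //.
by rewrite big1 ?addr0 // => k; rewrite eq_sym => /negPf->; rewrite mul0r mulr0.
Qed.

Let mat_T cd ab : (mat cd ab)^T = mat cd ab.
Proof.
by apply/matrixP => i j; rewrite !mxE; apply: eq_bigr => k _; ring.
Qed.

Let mat_sym cd ab v w : mat cd ab (pos v) (pos w) = mat cd ab (pos w) (pos v).
Proof. by rewrite -[in LHS]mat_T mxE. Qed.

Let mat_AB cd ab i j : units cd ->
  mat cd ab (pos (iA i)) (pos (iB j)) = \sum_k ab.1 (i, k) * ab.2 (j, k).
Proof.
move=> /andP[_ /forallP d0]; rewrite mat_pos; apply: eq_bigr => k _ /=.
by have := d0 k => dk; field.
Qed.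

Let rank_mxsub m (f g : 'I_m -> 'I_N) (M : 'M[K]_N) : (\rank (mxsub f g M) <= \rank M)%N.
Proof.
apply: (@leq_trans (\rank (rowsub f M))); last by rewrite mxrankS // rowsub_sub.
rewrite -mxrank_tr -[X in (_ <= X)%N]mxrank_tr mxrankS //.
have -> : (mxsub f g M)^T = rowsub g (rowsub f M)^T by apply/matrixP => i j; rewrite !mxE.
exact: rowsub_sub.
Qed.

Let mxsub_PL (M : 'M[K]_N) : good M ->
  mxsub (fun k => pos (iP k)) (fun k => pos (iL k)) M =
  diag_mx (\row_k M (pos (iP k)) (pos (iL k))).
Proof.
case/and3P => /sym_patternP[_ h] _ _; apply/matrixP => k l; rewrite !mxE.
case: eqP => [->|kl]; first by rewrite mulr1n.
by rewrite mulr0n h // /H ?(inj_eq enum_rank_inj) ?enum_rankK //=; apply/eqP.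
Qed.

Let mxsub_LL (M : 'M[K]_N) : good M ->
  mxsub (fun k => pos (iL k)) (fun k => pos (iL k)) M =
  diag_mx (\row_k M (pos (iL k)) (pos (iL k))).
Proof.
case/and3P => /sym_patternP[_ h] _ _; apply/matrixP => k l; rewrite !mxE.
case: eqP => [->|kl]; first by rewrite mulr1n.
rewrite mulr0n h // /H ?(inj_eq enum_rank_inj) ?enum_rankK //=.
by apply/eqP => -[].
Qed.

Let unit_diag n (d : 'rV[K]_n) : (diag_mx d \in unitmx) = [forall k, d 0 k != 0].
Proof.
rewrite unitmxE det_diag unitfE; apply/prodf_neq0/forallP => [h k|h k _]; exact: h.
Qed.

Let good_mat cd ab : units cd -> configuration ab -> good (mat cd ab).
Proof.
move=> u /and3P[/forallP fa /forallP fb /forallP ri].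
have /andP[/forallP c0 /forallP d0] := u.
have fitsa i k := forallP (fa i) k; have fitsb j k := forallP (fb j) k.
have Hmat : sym_pattern H (mat cd ab).
  apply/sym_patternP; split=> [|i j]; first exact: mat_T.
  rewrite -[i]enum_valK -[j]enum_valK /H !enum_rankK (inj_eq enum_rank_inj).
  move: (enum_val i) (enum_val j) => v w {i j}.
  have half v' w' : half_pair v' w' -> v' != w' -> ~~ free v' w' ->
      mat cd ab (pos v') (pos w') = 0.
    case: v' w' => [k|[k|[i|j]]] [l|[l|[i'|j']]] //= _ vw; rewrite ?mat_L //=.
    - by move/negPf->; rewrite mul0r.
    - have -> : (k == l) = false by apply: contraNF vw => /eqP->.
      by rewrite mul0r.
    - by rewrite negbK => /eqP pE; have := fitsa i l; rewrite pE /= eqbF_neg negbK => /eqP.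
    - by rewrite mat_AB // negbK => rij; apply/eqP; apply: (implyP (forallP (ri i) j')).
    - rewrite negbK => /eqP pE; have := fitsb j l; rewrite pE /= eqbF_neg negbK => /eqP->.
      by rewrite mul0r.
  have [vw|vw] := boolP (half_pair v w); first exact: half.
  have [wv|wv] := boolP (half_pair w v); first by rewrite freeC eq_sym -/(pos v) -/(pos w) mat_sym; exact: half.
  by case: v w vw wv => [k|[k|[i|j]]] [l|[l|[i'|j']]].
apply/and3P; split=> //.
  (* The factorisation through r columns bounds the rank above; the invertible diagonal block
     [iP]-[iL] bounds it below. *)
  rewrite eqn_leq; apply/andP; split.
    pose X : 'M[K]_(N, r) := \matrix_(i, k) (entries cd ab (enum_val i) k * (cd.2 k)^-1).
    pose Y : 'M[K]_(r, N) := \matrix_(k, j) entries cd ab (enum_val j) k.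
    have -> : mat cd ab = X *m Y.
      by apply/matrixP => i j; rewrite !mxE; apply: eq_bigr => k _; rewrite !mxE.
    exact: leq_trans (mxrankM_maxl _ _) (rank_leq_col _).
  pose D : 'M[K]_r := diag_mx (\row_k cd.1 k).
  have <- : \rank D = r.
    by apply: mxrank_unit; rewrite unit_diag; apply/forallP => k; rewrite mxE.
  have -> : D = mxsub (fun k => pos (iP k)) (fun k => pos (iL k)) (mat cd ab).
    apply/matrixP => k l; rewrite [RHS]mxE mat_L //= !mxE.
    by case: eqP => [->|_]; rewrite ?mulr1n ?mul1r // mulr0n mul0r.
  exact: rank_mxsub.
apply/forallP => i; apply/forallP => j; apply/implyP.
rewrite -[i]enum_valK -[j]enum_valK /S !enum_rankK.
move: (enum_val i) (enum_val j) => v w {i j}; rewrite -/(pos v) -/(pos w).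
case: v w => [k|[k|[i|j]]] [l|[l|[i'|j']]] //=; rewrite ?mat_L //= => /eqP.
- by move=> ->; rewrite eqxx mul1r.
- by move=> pE; have := fitsa i l; rewrite pE /= eqb_id.
- by move=> pE; have := fitsb j l; rewrite pE /= eqb_id => ?; rewrite mulf_neq0.
Qed.

Let cd_of (M : 'M[K]_N) : {ffun 'I_r -> K} * {ffun 'I_r -> K} :=
  ([ffun k => M (pos (iP k)) (pos (iL k))], [ffun k => M (pos (iL k)) (pos (iL k))]).

Let ab_of (M : 'M[K]_N) : {ffun A * 'I_r -> K} * {ffun B * 'I_r -> K} :=
  ([ffun x => M (pos (iA x.1)) (pos (iL x.2))],
   [ffun x => M (pos (iB x.1)) (pos (iL x.2)) / M (pos (iL x.2)) (pos (iL x.2))]).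

Let good_of (M : 'M[K]_N) : good M ->
  [/\ units (cd_of M), configuration (ab_of M) & mat (cd_of M) (ab_of M) = M].
Proof.
move=> gM; have /and3P[/sym_patternP[MT h] /eqP Mr /forallP nz] := gM.
have nzE v w : nonzero v w -> M (pos v) (pos w) != 0.
  by move=> vw; apply: (implyP (forallP (nz (pos v)) (pos w))); rewrite /S !enum_rankK.
have hE v w : v != w -> ~~ free v w -> M (pos v) (pos w) = 0.
  by move=> vw fvw; apply: h; rewrite ?(inj_eq enum_rank_inj) // /H !enum_rankK.
have fg_unit : mxsub (fun k => pos (iP k)) (fun k => pos (iL k)) M \in unitmx.
  by rewrite mxsub_PL // unit_diag; apply/forallP => k; rewrite mxE nzE /=.
have [D_unit ME] := sym_rank_decomposition MT Mr fg_unit.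
have dL := D_unit; rewrite mxsub_LL // unit_diag in dL.
have d0 k : M (pos (iL k)) (pos (iL k)) != 0.
  by have /forallP/(_ k) := dL; rewrite mxE.
have u : units (cd_of M).
  by apply/andP; split; apply/forallP => k; rewrite ffunE // nzE /=.
have entE v k : entries (cd_of M) (ab_of M) v k = M (pos v) (pos (iL k)).
  case: v => [l|[l|[i|j]]] /=; rewrite ?ffunE /= ?divfK //.
  - case: eqP => [->|lk]; first by rewrite mul1r.
    by rewrite mul0r hE //=; apply/eqP.
  - case: eqP => [->|lk]; first by rewrite mul1r.
    by rewrite mul0r hE //=; apply/eqP => -[].
have MEE v w : M (pos v) (pos w) =
    \sum_k M (pos v) (pos (iL k)) * (M (pos (iL k)) (pos (iL k)))^-1 * M (pos w) (pos (iL k)).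
  have invE : invmx (mxsub (fun k => pos (iL k)) (fun k => pos (iL k)) M) =
     diag_mx (\row_k (M (pos (iL k)) (pos (iL k)))^-1).
    rewrite -[RHS](mulKmx D_unit) -[LHS]mulmx1; congr (_ *m _).
    rewrite mxsub_LL // mulmx_diag -diag_const_mx; congr diag_mx.
    by apply/matrixP => i k; rewrite !mxE mulfV.
  have /matrixP/(_ (pos v) (pos w)) := ME; rewrite invE mul_mx_diag [RHS]mxE => ->.
  apply: eq_bigr => k _.
  by rewrite !mxE.
split=> //.
  have fitE w k p : free w (iL k) = (p != Some false) -> nonzero w (iL k) = (p == Some true) ->
      w != iL k -> fits p (M (pos w) (pos (iL k))).
    move=> fE nE wk; case: p fE nE => [[]|] //= fE nE.
      by rewrite nzE ?nE.
    by rewrite hE ?fE // eqxx.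
  apply/and3P; split.
  - by apply/forallP => i; apply/forallP => k; rewrite ffunE; exact: fitE.
  - apply/forallP => j; apply/forallP => k; rewrite ffunE /=.
    have := @fitE (iB j) k (pb j k) erefl erefl isT.
    by case: (pb j k) => //= b; rewrite mulf_eq0 invr_eq0 (negPf (d0 k)) orbF.
  - apply/forallP => i; apply/forallP => j; apply/implyP => rij.
    rewrite -(mat_AB (ab_of M) i j u); apply/eqP.
    have := @hE (iA i) (iB j) isT; rewrite /= rij => /(_ isT) <-.
    by rewrite MEE mat_pos; apply: eq_bigr => k _; rewrite !entE ffunE.
apply/matrixP => i j; rewrite -[i]enum_valK -[j]enum_valK.
rewrite -!/(pos _) mat_pos MEE; apply: eq_bigr => k _.
by rewrite !entE ffunE.
Qed.

Let card_good : #|[set M : 'M[K]_N | good M]| = #|[set x | units x.1 && configuration (K := K) x.2]|.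
Proof.
pose f x := mat x.1 x.2; pose g M := (cd_of M, ab_of M).
rewrite -!sum1_card [LHS](reindex_onto f g) /=; last first.
  by move=> M; rewrite inE => /good_of[].
apply: eq_bigl => -[cd ab]; rewrite !inE /=.
apply/andP/andP => [[gM /eqP gE]|[u cab]].
  by have [] := good_of gM; move: gE => [-> ->].
split; first exact: good_mat.
rewrite /g /f /=; case: cd ab u {cab} => [c d] [a b] u.
have /andP[_ /forallP d0] := u.
apply/eqP; congr ((_, _), (_, _)); apply/ffunP => k; rewrite ffunE !mat_L //=;
  rewrite ?eqxx ?mul1r //; last rewrite mulfK //; by rewrite -surjective_pairing.
Qed.

Lemma card_units_pair : #|[set cd | units cd]| = ((#|K|.-1 ^ r) ^ 2)%N.
Proof.
have -> : [set cd | units cd] = setX [set c : {ffun 'I_r -> K} | [forall k, c k != 0]]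
                                      [set d : {ffun 'I_r -> K} | [forall k, d k != 0]].
  by apply/setP => -[c d]; rewrite !inE.
by rewrite cardsX !card_ffun_neq0 card_ord mulnn.
Qed.

Lemma card_good_configuration :
  #|[set M : 'M[K]_N | good M]| = ((#|K|.-1 ^ r) ^ 2 * #|[set ab | configuration (K := K) ab]|)%N.
Proof.
rewrite card_good -card_units_pair -cardsX; apply: eq_card => -[cd ab].
by rewrite !inE.
Qed.

End Field.

Lemma Graphs_configuration :
  Graphs (fun q => #|[set ab | configuration (K := Fq q) ab]|%:R).
Proof.
apply: (Graphs_div (satS_exp 2 (satS_exp r satSXB1)) (Graphs_sym_rank_nonzero H r S_irr)) => q.
have q_gt0 : (0 < #|Fq q|)%N by rewrite card_Fq ltnW // pp_gt1.
rewrite card_good_configuration natrM 2!natrX -subn1 natrB // !pvalE.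
by have -> : #|Fq q|%:R = (q : nat)%:R :> rat by rewrite card_Fq.
Qed.

End Configurations.

(** * Arithmetic in the plane *)

Lemma eq_of_subr (V : zmodType) (x y u v : V) : u = v -> x - y = u - v -> x = y.
Proof. by move=> -> /eqP; rewrite subrr subr_eq0 => /eqP. Qed.

Section Gates.

Variables (I : finType) (one : I).

Definition gate : finType := (bool * (I * I * I))%type.

Definition gate_holds (R : nzRingType) (w : I -> R) (g : gate) : bool :=
  w g.2.2 == (if g.1 then w g.2.1.1 * w g.2.1.2 else w g.2.1.1 + w g.2.1.2).

Definition gate_solution (gs : {set gate}) (R : nzRingType) (w : I -> R) : bool :=
  (w one == 1) && [forall g, (g \in gs) ==> gate_holds w g].

Variable gs : {set gate}.

(* These gates, which hold as soon as w one = 1, force the values read off the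
   points X_i, Y_i and S_i to agree. *)
Let sync : {set gate} :=
  [set g : gate | g.1 && (((g.2.1.1 == one) && (g.2.1.2 == g.2.2)) ||
                          ((g.2.1.2 == one) && (g.2.1.1 == g.2.2)))].
Let gs' := gs :|: sync.

Let A : finType := ((I + I) + (I + I))%type.
Local Notation pX i := (inl (inl i) : A).
Local Notation pY i := (inl (inr i) : A).
Local Notation pS i := (inr (inl i) : A).
Local Notation pT i := (inr (inr i) : A).

Let B : finType := ({g : gate | g \in gs'} + option I)%type.
Local Notation lG g := (inl g : B).
Local Notation lH i := (inr (Some i) : B).
Local Notation lV := (inr None : B).

Let tri (T : Type) (x y z : T) (k : 'I_3) : T :=
  match val k with 0 => x | 1 => y | _ => z end.

Let ix : 'I_3 := ord0.
Let iy : 'I_3 := 1.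
Let iz : 'I_3 := 2%:R.

Let forall3 (P : 'I_3 -> Prop) : P ix -> P iy -> P iz -> forall k, P k.
Proof.
move=> Px Py Pz [[|[|[|//]]] lt_k].
- by rewrite (_ : Ordinal lt_k = ix) //; apply: val_inj.
- by rewrite (_ : Ordinal lt_k = iy) //; apply: val_inj.
- by rewrite (_ : Ordinal lt_k = iz) //; apply: val_inj.
Qed.

Let sum3 (R : nmodType) (F : 'I_3 -> R) : \sum_k F k = F ix + F iy + F iz.
Proof.
rewrite !big_ord_recl big_ord0 addr0 addrA; congr (_ + F _ + F _); exact: val_inj.
Qed.

Let St : option bool := Some true.
Let Ze : option bool := Some false.
Let Fr : option bool := None.

(** Apart from the normalising coordinates, only those equal to a scale of an axis are prescribed
    nonzero. The coordinates carrying an arbitrary value stay free, so that 0 is allowed. *)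
Let pa (v : A) : 'I_3 -> option bool :=
  match v with
  | inl (inl i) => tri St (if i == one then St else Fr) Ze
  | inl (inr i) => tri St Ze Fr
  | inr (inl i) => tri Ze St (if i == one then St else Fr)
  | inr (inr i) => tri St St Fr
  end.

Let pb (l : B) : 'I_3 -> option bool :=
  match l with
  | inl g => tri Fr Fr St
  | inr (Some i) => tri Fr Ze St
  | inr None => tri St St Ze
  end.

(** In the chart where the first coordinate is 1, X_i and Y_i lie on the two axes and S_i is a slope
    at infinity. [lV] is the parallel to the second axis through X_one and contains all T_i; [lH i],
    parallel to the first axis, carries Y_i to T_i. The line [lG] of a gate passes through Y_k with
    slope S_j; it meets the first axis in X_i for a product and [lV] in T_i for a sum. *)
Let rho (v : A) (l : B) : bool :=
  match l with
  | inl g => let g := val g in match v with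
    | inl (inl i) => g.1 && (i == g.2.1.1)
    | inl (inr i) => i == g.2.2
    | inr (inl i) => i == g.2.1.2
    | inr (inr i) => ~~ g.1 && (i == g.2.1.1)
    end
  | inr (Some j) => match v with inl (inr i) | inr (inr i) => i == j | _ => false end
  | inr None => match v with inl (inl i) => i == one | inr (inr i) => true | _ => false end
  end.

Section Field.

Variable K : finFieldType.

Let param : finType := ({ffun A -> K} * ({ffun B -> K} * ((K * K) * {ffun I -> K})))%type.

(* The line (a, b, 1) passes through S_j and Y_k iff b = t w_j and a = s t w_k;
   it then passes through X_i iff w_k = w_i w_j, and through T_i iff
   w_k = w_i + w_j.  The scales s and t of the axes are free. *)
Let pt (s t : K) (w : I -> K) (v : A) : 'I_3 -> K :=
  match v with
  | inl (inl i) => tri 1 (- (s * w i)) 0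
  | inl (inr i) => tri 1 0 (- (s * t * w i))
  | inr (inl i) => tri 0 1 (- (t * w i))
  | inr (inr i) => tri 1 (- s) (- (s * t * w i))
  end.

Let ln (s t : K) (w : I -> K) (l : B) : 'I_3 -> K :=
  match l with
  | inl g => tri (s * t * w (val g).2.2) (t * w (val g).2.1.2) 1
  | inr (Some i) => tri (s * t * w i) 0 1
  | inr None => tri s 1 0
  end.

Let conf (x : param) : {ffun A * 'I_3 -> K} * {ffun B * 'I_3 -> K} :=
  ([ffun vk => x.1 vk.1 * pt x.2.2.1.1 x.2.2.1.2 x.2.2.2 vk.1 vk.2],
   [ffun lk => x.2.1 lk.1 * ln x.2.2.1.1 x.2.2.1.2 x.2.2.2 lk.1 lk.2]).

Let dom : {set param} :=
  setX [set c : {ffun A -> K} | [forall v, c v != 0]]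
   (setX [set c : {ffun B -> K} | [forall l, c l != 0]]
    (setX (setX [set s | s != 0] [set t | t != 0])
       [set w : {ffun I -> K} | gate_solution gs w])).

Let dpt (v : A) : 'I_3 := match v with inr (inl _) => iy | _ => ix end.
Let dln (l : B) : 'I_3 := match l with inr None => iy | _ => iz end.

Let pt_d s t w v : pt s t w v (dpt v) = 1.
Proof. by case: v => [[]|[]]. Qed.

Let ln_d s t w l : ln s t w l (dln l) = 1.
Proof. by case: l => [|[]]. Qed.

Let conf_inj : {in dom &, injective conf}.
Proof.
move=> [c [d [[s t] w]]] [c' [d' [[s' t'] w']]].
rewrite !inE /= => /and3P[/forallP c0 /forallP d0 /andP[/andP[s0 t0] /andP[/eqP w1 _]]].
move=> /and3P[/forallP c0' /forallP d0' /andP[/andP[s0' t0'] /andP[/eqP w1' _]]].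
move=> [/ffunP ea /ffunP eb].
have cE : c = c' by apply/ffunP => v; have := ea (v, dpt v); rewrite !ffunE /= !pt_d !mulr1.
have dE : d = d' by apply/ffunP => l; have := eb (l, dln l); rewrite !ffunE /= !ln_d !mulr1.
subst c' d'.
have eaE v k : pt s t w v k = pt s' t' w' v k.
  by have := ea (v, k); rewrite !ffunE /= => /(mulfI (c0 v)).
have sE : s = s' by have := eaE (pT one) iy => /= /oppr_inj.
subst s'.
have tE : t = t'.
  by have := eaE (pS one) iz => /= /oppr_inj; rewrite w1 w1' !mulr1.
subst t'; suff -> : w = w' by [].
apply/ffunP => i; have := eaE (pX i) iy => /= /oppr_inj; exact: mulfI.
Qed.

Let conf_dom x : x \in dom -> configuration pa pb rho (conf x).
Proof.
case: x => [c [d [[s t] w]]].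
rewrite !inE /= => /and3P[/forallP c0 /forallP d0 /andP[/andP[s0 t0] /andP[/eqP w1 /forallP wg]]].
have wg' g : g \in gs' -> gate_holds w g.
  rewrite /gs' inE => /orP[|]; first by move=> gg; apply: (implyP (wg g)).
  rewrite inE /gate_holds => /andP[-> /orP[]/andP[/eqP-> /eqP->]]; by rewrite w1 ?mul1r ?mulr1.
apply/and3P; split.
- apply/forallP => v; apply/forallP; case: v => [[i|i]|[i|i]]; apply: forall3;
    rewrite ffunE /= /tri /= ?mulr1 ?mulr0 ?eqxx ?c0 //.
  + by case: eqP => //= ->; rewrite w1 mulr1 mulrN oppr_eq0 mulf_neq0.
  + by case: eqP => //= ->; rewrite w1 mulr1 mulrN oppr_eq0 mulf_neq0.
  + by rewrite /= mulrN oppr_eq0 mulf_neq0.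
- apply/forallP => l; apply/forallP; case: l => [g|[i|]]; apply: forall3;
    rewrite ffunE /= /tri /= ?mulr1 ?mulr0 ?eqxx ?d0 //.
  by rewrite mulf_neq0.
- apply/forallP => v; apply/forallP => l; apply/implyP => vl.
  rewrite sum3 !ffunE /=.
  have E k : c v * pt s t w v k * (d l * ln s t w l k) =
     c v * d l * (pt s t w v k * ln s t w l k) by ring.
  rewrite !E -!mulrDr mulf_eq0; apply/orP; right; move: vl; clear E.
  case: l => [[g gin]|[j|]]; case: v => [[i|i]|[i|i]] //=; rewrite /tri /=.
  + move=> /andP[g1 /eqP->]; have := wg' g gin; rewrite /gate_holds g1 => /eqP->.
    by apply/eqP; ring.
  + by move=> /eqP->; apply/eqP; ring.
  + by move=> /eqP->; apply/eqP; ring.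
  + move=> /andP[/negPf g1 /eqP->]; have := wg' g gin; rewrite /gate_holds g1 => /eqP->.
    by apply/eqP; ring.
  + by move=> /eqP->; apply/eqP; ring.
  + by move=> /eqP->; apply/eqP; ring.
  + by move=> /eqP->; rewrite w1; apply/eqP; ring.
  + by move=> _; apply/eqP; ring.
Qed.

Let dom_conf ab : configuration pa pb rho ab -> exists2 x, x \in dom & conf x = ab.
Proof.
case: ab => a b /and3P[/= /forallP fa /forallP fb /forallP inc].
have {}fa v k := forallP (fa v) k; have {}fb l k := forallP (fb l) k.
pose c v : K := a (v, dpt v); pose d l : K := b (l, dln l).
have c0 v : c v != 0 by have := fa v (dpt v); case: v => [[]|[]] i /=; rewrite eqb_id.
have d0 l : d l != 0 by have := fb l (dln l); case: l => [g|[i|]] /=; rewrite eqb_id.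
pose p v k := a (v, k) / c v; pose m l k := b (l, k) / d l.
have aE v k : a (v, k) = c v * p v k by rewrite mulrC divfK.
have bE l k : b (l, k) = d l * m l k by rewrite mulrC divfK.
have pd v : p v (dpt v) = 1 by exact: divff (c0 v).
have md l : m l (dln l) = 1 by exact: divff (d0 l).
have p0 v k : pa v k = Ze -> p v k = 0.
  by move=> e; have := fa v k; rewrite e /= eqbF_neg negbK /p => /eqP->; rewrite mul0r.
have m0 l k : pb l k = Ze -> m l k = 0.
  by move=> e; have := fb l k; rewrite e /= eqbF_neg negbK /m => /eqP->; rewrite mul0r.
have pN0 v k : pa v k = St -> p v k != 0.
  by move=> e; have := fa v k; rewrite e /= eqb_id => h; rewrite mulf_neq0 ?invr_eq0.
have incE v l : rho v l -> p v ix * m l ix + p v iy * m l iy + p v iz * m l iz = 0.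
  move=> vl; have := implyP (forallP (inc v) l) vl; rewrite sum3 !aE !bE => /eqP e.
  apply: (mulfI (mulf_neq0 (c0 v) (d0 l))); rewrite mulr0 -[RHS]e; ring.
pose s := - p (pX one) iy; pose t := - p (pS one) iz.
have s0 : s != 0 by rewrite oppr_eq0 pN0 //= eqxx.
have t0 : t != 0 by rewrite oppr_eq0 pN0 //= eqxx.
(* This is the future s t w_i; the values read at X_i, S_i and T_i are compared with it. *)
pose eta i := - p (pY i) iz.
have VE : m lV ix = s.
  have := incE (pX one) lV (eqxx _).
  rewrite (pd (pX one)) (md lV) (m0 lV iz erefl) => e.
  by apply: (eq_of_subr e); rewrite /s; ring.
have TE i : p (pT i) iy = - s.
  have := incE (pT i) lV isT; rewrite (pd (pT i)) (md lV) (m0 lV iz erefl) VE => e.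
  by apply: (eq_of_subr e); ring.
have HE i : m (lH i) ix = eta i.
  have := incE (pY i) (lH i) (eqxx _).
  rewrite (pd (pY i)) (md (lH i)) (m0 (lH i) iy erefl) => e.
  by apply: (eq_of_subr e); rewrite /eta; ring.
have TE2 i : p (pT i) iz = - eta i.
  have := incE (pT i) (lH i) (eqxx _).
  rewrite (pd (pT i)) (md (lH i)) (m0 (lH i) iy erefl) HE => e.
  by apply: (eq_of_subr e); ring.
have GY g : m (lG g) ix = eta (val g).2.2.
  have := incE (pY (val g).2.2) (lG g) (eqxx _).
  rewrite (pd (pY _)) (md (lG g)) (p0 (pY _) iy erefl) => e.
  by apply: (eq_of_subr e); rewrite /eta; ring.
have GS g : m (lG g) iy = - p (pS (val g).2.1.2) iz.
  have := incE (pS (val g).2.1.2) (lG g) (eqxx _).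
  rewrite (pd (pS _)) (md (lG g)) (p0 (pS _) ix erefl) => e.
  by apply: (eq_of_subr e); ring.
have mulE i j k : (true, (i, j, k)) \in gs' ->
    eta k = p (pX i) iy * p (pS j) iz.
  move=> gin; pose g : {g | g \in gs'} := exist (fun g => g \in gs') _ gin.
  have := incE (pX i) (lG g) (eqxx _).
  rewrite (pd (pX _)) (md (lG g)) (p0 (pX _) iz erefl) GY GS /= => e.
  by apply: (eq_of_subr e); ring.
have addE i j k : (false, (i, j, k)) \in gs' ->
    eta k = - s * p (pS j) iz + eta i.
  move=> gin; pose g : {g | g \in gs'} := exist (fun g => g \in gs') _ gin.
  have := incE (pT i) (lG g) (eqxx _).
  rewrite (pd (pT _)) (md (lG g)) TE TE2 GY GS /= => e.
  by apply: (eq_of_subr e); ring.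
(* From the synchronising gates 1 * i = i here and i * 1 = i next. *)
have etaS i : eta i = s * - p (pS i) iz.
  by rewrite (@mulE one i i) ?inE /= ?eqxx ?orbT // /s; ring.
have etaX i : eta i = t * - p (pX i) iy.
  by rewrite (@mulE i one i) ?inE /= ?eqxx ?orbT // /t; ring.
pose w : {ffun I -> K} := [ffun i => eta i / (s * t)].
have st0 : s * t != 0 by rewrite mulf_neq0.
have etaw i : eta i = s * t * w i by rewrite ffunE mulrC divfK.
have Sw i : p (pS i) iz = - (t * w i).
  by apply: (mulfI s0); have := etaw i; rewrite etaS => /esym/eq_of_subr; apply; ring.
have Xw i : p (pX i) iy = - (s * w i).
  by apply: (mulfI t0); have := etaw i; rewrite etaX => /esym/eq_of_subr; apply; ring.
have w1 : w one = 1.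
  by apply: (mulfI s0); rewrite mulr1 -[LHS]opprK -Xw.
exists ([ffun v => c v], ([ffun l => d l], ((s, t), w))).
  rewrite !inE /= s0 t0; apply/and3P; split.
  - by apply/forallP => v; rewrite ffunE.
  - by apply/forallP => l; rewrite ffunE.
  rewrite /= /gate_solution w1 eqxx; apply/forallP => -[[] [[i j] k]]; apply/implyP => gin.
    rewrite /gate_holds /=; have gin' : (true, (i, j, k)) \in gs' by rewrite inE gin.
    have := mulE _ _ _ gin'; rewrite Xw Sw etaw => e; apply/eqP.
    by apply: (mulfI st0); rewrite e; ring.
  rewrite /gate_holds /=; have gin' : (false, (i, j, k)) \in gs' by rewrite inE gin.
  have := addE _ _ _ gin'; rewrite Sw !etaw => e; apply/eqP.
  by apply: (mulfI st0); rewrite e; ring.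
congr (_, _); apply/ffunP => -[].
  move=> v k; rewrite !ffunE /= aE; congr (_ * _); move: k; apply: forall3.
  - by case: v => [[i|i]|[i|i]] /=; rewrite ?(p0 (pS i) ix erefl) // (pd (pX i), pd (pY i), pd (pT i)).
  - by case: v => [[i|i]|[i|i]] /=; rewrite ?Xw ?TE ?(pd (pS i)) ?(p0 (pY i) iy erefl).
  - case: v => [[i|i]|[i|i]] /=; rewrite ?(p0 (pX i) iz erefl) ?Sw ?TE2 ?etaw //.
    by rewrite /tri /= -etaw opprK.
move=> l k; rewrite !ffunE /= bE; congr (_ * _); move: k; apply: forall3.
- by case: l => [g|[i|]] /=; rewrite ?GY ?HE ?VE ?etaw.
- by case: l => [g|[i|]] /=; rewrite ?GS ?(m0 (lH i) iy erefl) ?(md lV) // Sw opprK.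
- by case: l => [g|[i|]] /=; rewrite ?(md (lG g)) ?(md (lH i)) ?(m0 lV iz erefl).
Qed.

Lemma card_gate_configuration :
  #|[set ab | configuration (K := K) pa pb rho ab]| =
  (#|K|.-1 ^ #|A| * (#|K|.-1 ^ #|B| * ((#|K|.-1 * #|K|.-1) *
     #|[set w : {ffun I -> K} | gate_solution gs w]|)))%N.
Proof.
have -> : [set ab | configuration pa pb rho ab] = conf @: dom.
  apply/setP => ab; rewrite inE; apply/idP/imsetP => [/dom_conf[x]|[x xd ->]].
    by exists x.
  exact: conf_dom.
rewrite card_in_imset; last exact: conf_inj.
rewrite /dom !cardsX !card_ffun_neq0.
have -> : [set s : K | s != 0] = ~: [set 0] by apply/setP => s; rewrite !inE.
by rewrite cardsC1.
Qed.

End Field.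

Lemma Graphs_gate_solution :
  Graphs (fun q => #|[set w : {ffun I -> Fq q} | gate_solution gs w]|%:R).
Proof.
pose s : {poly int} := 'X - 1.
have sS : satS (s ^+ #|A| * (s ^+ #|B| * (s * s))).
  by do ![apply: satS_mul | apply: satS_exp | exact: satSXB1].
apply: (Graphs_div sS (Graphs_configuration pa pb rho)) => q.
have q_gt0 : (0 < #|Fq q|)%N by rewrite card_Fq ltnW // pp_gt1.
have sE : pval s q = (#|Fq q|.-1)%:R.
  by rewrite !pvalE -subn1 natrB // card_Fq.
rewrite card_gate_configuration !natrM 2!natrX 3!pvalM 2!pval_exp sE.
by rewrite -!mulrA.
Qed.

End Gates.

(** * Systems of equations with integer coefficients *)

(** Polynomials as syntax: they can be evaluated in every ring, the zero ring included, and compiled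
    to gates by structural induction. *)
Inductive rexp (n : nat) : Type :=
  | RZero | ROne | RVar of 'I_n | RAdd of rexp n & rexp n | ROpp of rexp n | RMul of rexp n & rexp n.
Arguments RZero {n}.
Arguments ROne {n}.

Fixpoint reval n (R : pzRingType) (x : 'I_n -> R) (e : rexp n) : R :=
  match e with
  | RZero => 0
  | ROne => 1
  | RVar i => x i
  | RAdd e1 e2 => reval x e1 + reval x e2
  | ROpp e1 => - reval x e1
  | RMul e1 e2 => reval x e1 * reval x e2
  end.

Lemma eq_reval n (R : pzRingType) (x y : 'I_n -> R) e : x =1 y -> reval x e = reval y e.
Proof. by move=> xy; elim: e => //= [e1 -> e2 ->|e1 ->|e1 -> e2 ->]. Qed.

Record gate_system := GateSystem {
  gs_index : finType;
  gs_one : gs_index;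
  gs_zero : gs_index;
  gs_gates : {set gate gs_index}
}.

Definition system_solution (S : gate_system) (K : finFieldType) (w : {ffun gs_index S -> K}) : bool :=
  gate_solution (gs_one S) (gs_gates S) w && (w (gs_zero S) == 0).

(** Restriction along [v] is a bijection from solutions to points of P, uniformly in the field:
    auxiliary variables are determined, so the counts agree. *)
Definition parametrizes (S : gate_system) (J : finType) (v : J -> gs_index S)
    (P : forall K : finFieldType, {ffun J -> K} -> bool) : Prop :=
  forall K : finFieldType,
  [/\ forall w : {ffun gs_index S -> K}, system_solution w -> P K [ffun j => w (v j)],
      forall x : {ffun J -> K}, P K x ->
        exists2 w : {ffun gs_index S -> K}, system_solution w & [ffun j => w (v j)] = x
    & forall w w' : {ffun gs_index S -> K}, system_solution w -> system_solution w' ->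
        (forall j, w (v j) = w' (v j)) -> w = w'].

Lemma parametrizes_id S : parametrizes (@id (gs_index S)) (@system_solution S).
Proof.
move=> K; have idE (w : {ffun gs_index S -> K}) : [ffun j => w (id j)] = w by apply/ffunP => j; rewrite ffunE.
split=> [w|w sw|w w' _ _ ww']; first by rewrite idE.
  by exists w.
exact/ffunP.
Qed.

Lemma parametrizes_comp S S' (J : finType) (v : J -> gs_index S) iota P :
  parametrizes v P -> parametrizes iota (@system_solution S) ->
  parametrizes (S := S') (iota \o v) P.
Proof.
move=> pv pi K; have [v1 v2 v3] := pv K; have [i1 i2 i3] := pi K.
have compE (w : {ffun gs_index S' -> K}) :
    [ffun j => w ((iota \o v) j)] = [ffun j => [ffun i => w (iota i)] (v j)].
  by apply/ffunP => j; rewrite !ffunE.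
split=> [w /i1 /v1|x /v2[w /i2[w' sw' <-] <-]|w w' sw sw' ww']; first by rewrite compE.
  by exists w'.
apply: i3 => // i.
have /ffunP/(_ i) : [ffun i => w (iota i)] = [ffun i => w' (iota i)].
  by apply: v3; [exact: i1 | exact: i1 | move=> j; rewrite !ffunE; exact: ww'].
by rewrite !ffunE.
Qed.

Definition map_gate (I J : finType) (f : I -> J) (g : gate I) : gate J :=
  (g.1, (f g.2.1.1, f g.2.1.2, f g.2.2)).

Definition add_variable (S : gate_system) (g : gate (option (gs_index S))) : gate_system :=
  @GateSystem (option (gs_index S)) (Some (gs_one S)) (Some (gs_zero S))
    (g |: map_gate Some @: gs_gates S).

Lemma add_variable_solution S g (K : finFieldType) (w : {ffun gs_index (@add_variable S g) -> K}) :
  system_solution w = gate_holds w g && system_solution [ffun i => w (Some i)].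
Proof.
rewrite /system_solution /gate_solution /= !ffunE.
case: (w (Some (gs_one S)) == 1); rewrite ?andbF //=.
case: (w (Some (gs_zero S)) == 0); rewrite ?andbF //= !andbT.
apply/forallP/andP => [h|[hg /forallP h] g'].
  split; first by have := h g; rewrite !inE eqxx.
  apply/forallP => g'; apply/implyP => g'S; have := implyP (h (map_gate Some g')).
  by rewrite !inE imset_f ?orbT // /gate_holds /= !ffunE => /(_ isT).
apply/implyP; rewrite !inE => /orP[/eqP->//|/imsetP[g0 g0S ->]].
by have := implyP (h g0) g0S; rewrite /gate_holds /= !ffunE.
Qed.

Lemma parametrizes_add_variable S (g : gate (option (gs_index S)))
    (f : forall K : finFieldType, (gs_index S -> K) -> K) :
  (forall (K : finFieldType) (w : {ffun option (gs_index S) -> K}), w (Some (gs_zero S)) = 0 ->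
     gate_holds w g = (w None == f K (fun i => w (Some i)))) ->
  (forall (K : finFieldType) (x y : gs_index S -> K), x =1 y -> f K x = f K y) ->
  parametrizes (S := add_variable g) Some (@system_solution S).
Proof.
move=> gE fE K.
have gE' (w : {ffun option (gs_index S) -> K}) :
    system_solution (S := add_variable g) w =
    (w None == f K (fun i => w (Some i))) && system_solution (S := S) [ffun i => w (Some i)].
  rewrite add_variable_solution; case sw: (system_solution [ffun i => w (Some i)]); rewrite ?andbF //.
  rewrite !andbT gE //; move: sw; rewrite /system_solution => /andP[_ /eqP].
  by rewrite ffunE.
split=> [w|w sw|w w'].
- by rewrite gE' => /andP[].
- pose w' : {ffun option (gs_index S) -> K} := [ffun i => if i is Some i then w i else f K w].
  have w'E : [ffun i => w' (Some i)] = w by apply/ffunP => i; rewrite !ffunE.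
  exists w' => //; rewrite gE' w'E sw andbT ffunE; apply/eqP/fE => i; by rewrite ffunE.
- rewrite !gE' => /andP[/eqP e _] /andP[/eqP e' _] ww'.
  by apply/ffunP => -[i|]; [exact: ww' | rewrite e e'; apply: fE].
Qed.

Lemma compile_rexp n (e : rexp n) (S : gate_system) (v : 'I_n -> gs_index S) :
  exists (S' : gate_system) (iota : gs_index S -> gs_index S') (k : gs_index S'),
    parametrizes iota (@system_solution S) /\
    forall (K : finFieldType) (w : {ffun gs_index S' -> K}), system_solution w ->
      w k = reval (fun i => w (iota (v i))) e.
Proof.
elim: e S v => [||i|e1 IH1 e2 IH2|e IH|e1 IH1 e2 IH2] S v.
- exists S, id, (gs_zero S); split=> [|K w]; first exact: parametrizes_id.
  by case/andP => _ /eqP.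
- exists S, id, (gs_one S); split=> [|K w]; first exact: parametrizes_id.
  by case/andP => /andP[/eqP].
- by exists S, id, (v i); split=> //; exact: parametrizes_id.
- have [S1 [i1 [k1 [p1 E1]]]] := IH1 S v; have [S2 [i2 [k2 [p2 E2]]]] := IH2 S1 (i1 \o v).
  pose g : gate (option (gs_index S2)) := (false, (Some (i2 k1), Some k2, None)).
  have pg : parametrizes (S := add_variable g) Some (@system_solution S2).
    by apply: (@parametrizes_add_variable _ g (fun K w => w (i2 k1) + w k2)) => [//|K x y xy]; rewrite !xy.
  exists (add_variable g), (Some \o (i2 \o i1)), None; split.
    exact: parametrizes_comp (parametrizes_comp p1 p2) pg.
  move=> K w; rewrite add_variable_solution => /andP[/eqP /= -> sw].
  have [/(_ _ sw) sw1 _ _] := p2 K.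
  by have := E1 _ _ sw1; have := E2 _ _ sw; rewrite !ffunE => -> ->; congr (_ + _); apply: eq_reval => i;
    rewrite !ffunE.
- have [S1 [i1 [k1 [p1 E1]]]] := IH S v.
  (* Subtraction by an addition gate: [k1] plus the new variable is 0. *)
  pose g : gate (option (gs_index S1)) := (false, (Some k1, None, Some (gs_zero S1))).
  have pg : parametrizes (S := add_variable g) Some (@system_solution S1).
    apply: (@parametrizes_add_variable _ g (fun K w => - w k1)) => [K w w0|K x y xy]; last by rewrite !xy.
    by rewrite /gate_holds /= w0 eq_sym addrC addr_eq0.
  exists (add_variable g), (Some \o i1), None; split; first exact: parametrizes_comp p1 pg.
  move=> K w; rewrite add_variable_solution => /andP[/eqP /= e0 sw].
  have := E1 _ _ sw; rewrite ffunE => k1E.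
  have w0 : w (Some (gs_zero S1)) = 0 by case/andP: sw => _ /eqP; rewrite ffunE.
  have -> : w None = - w (Some k1).
    by apply/eqP; rewrite -addr_eq0 addrC -e0 w0.
  by rewrite k1E; congr (- _); apply: eq_reval => i; rewrite ffunE.
- have [S1 [i1 [k1 [p1 E1]]]] := IH1 S v; have [S2 [i2 [k2 [p2 E2]]]] := IH2 S1 (i1 \o v).
  pose g : gate (option (gs_index S2)) := (true, (Some (i2 k1), Some k2, None)).
  have pg : parametrizes (S := add_variable g) Some (@system_solution S2).
    by apply: (@parametrizes_add_variable _ g (fun K w => w (i2 k1) * w k2)) => [//|K x y xy]; rewrite !xy.
  exists (add_variable g), (Some \o (i2 \o i1)), None; split.
    exact: parametrizes_comp (parametrizes_comp p1 p2) pg.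
  move=> K w; rewrite add_variable_solution => /andP[/eqP /= -> sw].
  have [/(_ _ sw) sw1 _ _] := p2 K.
  by have := E1 _ _ sw1; have := E2 _ _ sw; rewrite !ffunE => -> ->; congr (_ * _); apply: eq_reval => i;
    rewrite !ffunE.
Qed.

Definition zeros n (es : seq (rexp n)) (R : comPzRingType) (x : {ffun 'I_n -> R}) : bool :=
  all (fun e => reval x e == 0) es.

Lemma parametrizes_zeros n (es : seq (rexp n)) :
  exists (S : gate_system) (v : 'I_n -> gs_index S), parametrizes v (fun K => @zeros n es K).
Proof.
elim: es => [|e es [S [v pv]]].
  pose S := @GateSystem (option (option 'I_n)) None (Some None) set0.
  exists S, (fun i => Some (Some i)) => K.
  have sE (w : {ffun option (option 'I_n) -> K}) :
      system_solution (S := S) w = (w None == 1) && (w (Some None) == 0).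
    rewrite /system_solution /gate_solution /= (_ : [forall g, _] = true) ?andbT //.
    by apply/forallP => g; rewrite inE.
  split=> [//|x _|w w'].
    pose w : {ffun option (option 'I_n) -> K} :=
      [ffun i => if i is Some i then if i is Some i then x i else 0 else 1].
    exists w; first by rewrite sE !ffunE !eqxx.
    by apply/ffunP => i; rewrite !ffunE.
  rewrite !sE => /andP[/eqP w1 /eqP w0] /andP[/eqP w1' /eqP w0'] ww'.
  by apply/ffunP => -[[i|]|]; rewrite ?w1 ?w0 // ww'.
have [S1 [i1 [k [p1 E1]]]] := compile_rexp e v.
have pv1 := parametrizes_comp pv p1.
(* The gate k = k + k forces the value of the compiled expression to be 0. *)
pose S' := GateSystem (gs_one S1) (gs_zero S1) ((false, (k, k, k)) |: gs_gates S1).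
exists S', (i1 \o v) => K; have [h1 h2 h3] := pv1 K.
have sE (w : {ffun gs_index S1 -> K}) :
    system_solution (S := S') w = (w k == 0) && system_solution (S := S1) w.
  rewrite /system_solution /gate_solution /= andbA andbA; congr (_ && _).
  rewrite [(w k == 0) && _]andbC -andbA; congr (_ && _).
  apply/forallP/andP => [h|[k0 /forallP h] g].
    split.
      have := h (false, (k, k, k)); rewrite !inE eqxx /= /gate_holds /=.
      by rewrite -[X in X == _]addr0 (inj_eq (addrI _)) eq_sym.
    by apply/forallP => g; apply/implyP => gS; apply: (implyP (h g)); rewrite !inE gS orbT.
  apply/implyP; rewrite !inE => /orP[/eqP->|gS]; last exact: (implyP (h g)).
  by rewrite /gate_holds /= (eqP k0) addr0.
have zE (w : {ffun gs_index S1 -> K}) : system_solution (S := S1) w ->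
    (reval [ffun j => w ((i1 \o v) j)] e == 0) = (w k == 0).
  by move=> sw; rewrite (E1 _ _ sw); congr (_ == _); apply: eq_reval => i; rewrite ffunE.
split=> [w|x|w w'].
- by rewrite sE => /andP[k0 sw]; rewrite /zeros /= zE // k0; exact: h1.
- rewrite /zeros /= => /andP[x0 /h2[w sw wx]]; exists w => //.
  by rewrite sE sw -zE // wx x0.
- by rewrite !sE => /andP[_ sw] /andP[_ sw']; exact: h3.
Qed.

Lemma Graphs_zeros n (es : seq (rexp n)) :
  Graphs (fun q => #|[set x : {ffun 'I_n -> Fq q} | zeros es x]|%:R).
Proof.
have [S [v pv]] := parametrizes_zeros es.
pose gs := (false, (gs_zero S, gs_zero S, gs_zero S)) |: gs_gates S.
apply: span_ext (Graphs_gate_solution (gs_one S) gs) => q; congr (_%:R).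
have [h1 h2 h3] := pv (Fq q).
have -> : [set w : {ffun gs_index S -> Fq q} | gate_solution (gs_one S) gs w] =
          [set w | system_solution w].
  apply/setP => w; rewrite !inE /system_solution /gate_solution -andbA; congr (_ && _).
  apply/forallP/andP => [h|[/forallP h z0] g].
    split; last first.
      have := h (false, (gs_zero S, gs_zero S, gs_zero S)); rewrite !inE eqxx /= /gate_holds /=.
      by rewrite -[X in X == _]addr0 (inj_eq (addrI _)) eq_sym.
    by apply/forallP => g; apply/implyP => gS; apply: (implyP (h g)); rewrite !inE gS orbT.
  apply/implyP; rewrite !inE => /orP[/eqP->|gS]; last exact: (implyP (h g)).
  by rewrite /gate_holds /= (eqP z0) addr0.
pose f (w : {ffun gs_index S -> Fq q}) := [ffun j => w (v j)].
rewrite -(card_in_imset (f := f)); last first.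
  move=> w w'; rewrite !inE => sw sw' /ffunP ww'; apply: h3 => // j.
  by have := ww' j; rewrite !ffunE.
apply: eq_card => x; rewrite inE; apply/imsetP/idP => [[w]|/h2[w sw wx]].
  by rewrite inE => sw ->; exact: h1.
by exists w; rewrite ?inE.
Qed.

(** * Hilbert's basis theorem *)

Lemma mpoly_int_ind n (Q : {mpoly int[n]} -> Prop) :
  Q 1 -> (forall i, Q 'X_i) -> (forall P P', Q P -> Q P' -> Q (P + P')) ->
  (forall P, Q P -> Q (- P)) -> (forall P P', Q P -> Q P' -> Q (P * P')) -> forall P, Q P.
Proof.
move=> Q1 QX QD QN QM P.
have Q0 : Q 0 by rewrite -(subrr 1); apply: QD => //; exact: QN.
have Qn k : Q k%:R by elim: k => // k IH; rewrite -natr1; apply: QD.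
have Qz (c : int) : Q c%:~R by case: c => k; [exact: Qn | rewrite NegzE mulrNz; apply: QN; exact: Qn].
have QXn i k : Q ('X_i ^+ k) by elim: k => [|k IH]; rewrite ?expr0 // exprS; apply: QM.
rewrite (mpolyE P); elim: (msupp P : seq _) => [|m r IH]; first by rewrite big_nil.
rewrite big_cons; apply: QD => //.
rewrite -[P@_m]intz scaler_int -mulrzl; apply: (QM _ _); first exact: Qz.
rewrite mpolyXE_id; elim: (index_enum _) => [|i s IH']; first by rewrite big_nil.
by rewrite big_cons; apply: QM.
Qed.

Lemma mpoly_int_morph_eq n (R : pzRingType) (phi psi : {rmorphism {mpoly int[n]} -> R}) :
  (forall i, phi 'X_i = psi 'X_i) -> phi =1 psi.
Proof.
move=> h; apply: mpoly_int_ind => //; first by rewrite !rmorph1.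
- by move=> P P' e e'; rewrite !rmorphD e e'.
- by move=> P e; rewrite !rmorphN e.
- by move=> P P' e e'; rewrite !rmorphM e e'.
Qed.

Lemma mpoly_int_rexp n (P : {mpoly int[n]}) :
  exists e : rexp n, forall (R : comNzRingType) (x : 'I_n -> R), ieval x P = reval x e.
Proof.
move: P; apply: mpoly_int_ind.
- by exists ROne => R x; rewrite rmorph1.
- by move=> i; exists (RVar i) => R x; rewrite ievalX.
- by move=> P P' [e h] [e' h']; exists (RAdd e e') => R x; rewrite rmorphD h h'.
- by move=> P [e h]; exists (ROpp e) => R x; rewrite rmorphN h.
- by move=> P P' [e h] [e' h']; exists (RMul e e') => R x; rewrite rmorphM h h'.
Qed.

Section Ideals.

Variable R : comNzRingType.

Inductive ideal (S : R -> Prop) : R -> Prop :=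
  | ideal_gen a : S a -> ideal S a
  | ideal_zero : ideal S 0
  | ideal_add a b : ideal S a -> ideal S b -> ideal S (a + b)
  | ideal_mul c a : ideal S a -> ideal S (c * a).

Lemma ideal_sub (S T : R -> Prop) : (forall a, S a -> ideal T a) -> forall a, ideal S a -> ideal T a.
Proof.
move=> ST a; elim=> {a} [a /ST //||a b _ ha _ hb|c a _ ha].
- exact: ideal_zero.
- exact: ideal_add.
- exact: ideal_mul.
Qed.

Lemma idealB (S : R -> Prop) a b : ideal S a -> ideal S b -> ideal S (a - b).
Proof. by move=> ha hb; rewrite -mulN1r; apply: ideal_add ha (ideal_mul _ hb). Qed.

Lemma ideal_finite (S : R -> Prop) a : ideal S a ->
  exists2 l : seq R, (forall b, b \in l -> S b) & ideal (fun b => b \in l) a.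
Proof.
elim=> {a} [a Sa||a b _ [l lS la] _ [l' lS' lb]|c a _ [l lS la]].
- by exists [:: a] => [b|]; [rewrite inE => /eqP-> | apply: ideal_gen; rewrite inE].
- by exists [::] => //; exact: ideal_zero.
- exists (l ++ l') => [c|]; first by rewrite mem_cat => /orP[/lS|/lS'].
  apply: ideal_add.
    by apply: ideal_sub la => d dl; apply: ideal_gen; rewrite mem_cat dl.
  by apply: ideal_sub lb => d dl; apply: ideal_gen; rewrite mem_cat dl orbT.
- by exists l => //; exact: ideal_mul.
Qed.

Lemma ideal_finite_seq (S : R -> Prop) (r : seq R) : (forall a, a \in r -> ideal S a) ->
  exists2 l : seq R, (forall b, b \in l -> S b) & forall a, a \in r -> ideal (fun b => b \in l) a.
Proof.
elim: r => [|a r IH] rS; first by exists [::].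
have [|l lS lr] := IH; first by move=> b br; apply: rS; rewrite inE br orbT.
have [|l' lS' la] := @ideal_finite S a; first by apply: rS; rewrite inE eqxx.
exists (l' ++ l) => [b|b]; first by rewrite mem_cat => /orP[/lS'|/lS].
rewrite inE => /orP[/eqP->|/lr].
  by apply: ideal_sub la => d dl; apply: ideal_gen; rewrite mem_cat dl.
by apply: ideal_sub => d dl; apply: ideal_gen; rewrite mem_cat dl orbT.
Qed.

(** The generators are drawn from S itself, so that an infinite system of equations reduces to
    finitely many of its own members. *)
Definition noetherian : Prop :=
  forall S : R -> Prop, exists2 l : seq R, (forall a, a \in l -> S a) &
    forall a, S a -> ideal (fun b => b \in l) a.

End Ideals.

Lemma noetherian_int : noetherian int.
Proof.
move=> S; pose Q d := (0 < d)%N && `[< ideal S d%:Z >].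
have absS a : ideal S a -> ideal S (`|a|%N)%:Z.
  case: a => n Sa //=; rewrite -[n.+1%:Z]opprK -NegzE -mulN1r.
  exact: ideal_mul.
have [[d Qd]|Q0] := pselect (exists d, Q d); last first.
  exists [::] => // a Sa; suff -> : a = 0 by exact: ideal_zero.
  apply/eqP; apply: contra_notT Q0 => a0; exists `|a|%N.
  by rewrite /Q absz_gt0 a0; apply/asboolP/absS; exact: ideal_gen.
have exQ : exists d, Q d by exists d.
case: (ex_minnP exQ) => {Qd}d /andP[d0 /asboolP Sd] d_min.
have [l lS ld] := ideal_finite Sd; exists l => // a Sa.
have -> : a = (a %/ d%:Z)%Z * d%:Z.
  have : ideal S (a %% d%:Z)%Z.
    have -> : (a %% d%:Z)%Z = a - (a %/ d%:Z)%Z * d%:Z by rewrite {2}(divz_eq a d%:Z) addrC addKr.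
    by apply: idealB; [exact: ideal_gen | exact: ideal_mul].
  move=> /absS Sr; rewrite [LHS](divz_eq a d%:Z).
  have [->|r0] := eqVneq (a %% d%:Z)%Z 0; first by rewrite addr0.
  have /d_min : Q `|(a %% d%:Z)%Z|%N by rewrite /Q absz_gt0 r0; exact/asboolP.
  have := @ltz_pmod a d%:Z; have := @modz_ge0 a d%:Z; lia.
exact: ideal_mul.
Qed.

Section Hilbert.

Variable R : comNzRingType.
Hypothesis noethR : noetherian R.

(** The degree is at most d and [a] may be 0; for an ideal J these coefficients therefore form an
    ideal of R, which grows with d. *)
Definition leading (J : {poly R} -> Prop) (d : nat) (a : R) : Prop :=
  exists p : {poly R}, [/\ J p, (size p <= d.+1)%N & p`_d = a].

Lemma leading_ideal J d a : (forall p, ideal J p -> J p) ->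
  ideal (leading J d) a -> leading J d a.
Proof.
move=> JJ; elim=> {a} [//||a b _ [p [Jp sp <-]] _ [p' [Jp' sp' <-]]|c a _ [p [Jp sp <-]]].
- by exists 0; rewrite size_poly0 coef0; split=> //; apply/JJ/ideal_zero.
- exists (p + p'); rewrite coefD; split=> //.
    by apply: JJ; apply: ideal_add; exact: ideal_gen.
  by apply: leq_trans (size_polyD _ _) _; rewrite geq_max sp sp'.
- exists (c%:P * p); rewrite coefCM; split=> //.
    by apply: JJ; apply: ideal_mul; exact: ideal_gen.
  by rewrite mul_polyC; apply: leq_trans (size_scale_leq _ _) sp.
Qed.

Lemma leading_leq J d d' a : (forall p, ideal J p -> J p) -> (d <= d')%N ->
  leading J d a -> leading J d' a.
Proof.
move=> JJ dd' [p [Jp sp <-]]; exists ('X^(d' - d) * p); split.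
- by apply: JJ; apply: ideal_mul; exact: ideal_gen.
- apply: leq_trans (size_polyMleq _ _) _; rewrite size_polyXn.
  by rewrite addSn /= -(leq_add2l (d' - d)) addnS subnK // in sp *.
- by rewrite coefXnM ltnNge leq_subr /= subKn.
Qed.

Lemma noetherian_poly : noetherian {poly R}.
Proof.
move=> S; pose J := ideal S.
have JJ (T : {poly R} -> Prop) p : ideal (ideal T) p -> ideal T p by exact: ideal_sub.
have fin d (l : seq R) : (forall a, a \in l -> leading J d a) ->
    exists2 F : seq {poly R}, (forall p, p \in F -> J p) &
      forall a, a \in l -> leading (ideal (fun p => p \in F)) d a.
  elim: l => [|a l IH] lJ; first by exists [::].
  have [|F FJ Fl] := IH; first by move=> b bl; apply: lJ; rewrite inE bl orbT.
  have [|p [Jp sp pa]] := lJ a; first by rewrite inE eqxx.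
  exists (p :: F) => [p'|b]; first by rewrite inE => /orP[/eqP->|/FJ].
  rewrite inE => /orP[/eqP->|/Fl[p' [Fp' sp' pb]]].
    by exists p; split=> //; apply: ideal_gen; rewrite inE eqxx.
  exists p'; split=> //; apply: ideal_sub Fp' => g gF; apply: ideal_gen.
  by rewrite inE gF orbT.
have at_degree d : exists2 F : seq {poly R}, (forall p, p \in F -> J p) &
    forall a, leading J d a -> leading (ideal (fun p => p \in F)) d a.
  have [l lJ Jl] := noethR (leading J d); have [F FJ Fl] := fin d l lJ.
  exists F => // a /Jl la; apply: leading_ideal; first exact: JJ.
  by apply: ideal_sub la => b /Fl bF; exact: ideal_gen.
(* In degree D all generators of the ideal of all leading coefficients are present; powers of X
   carry them to higher degrees. The finitely many degrees below D are treated one by one. *)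
have [D [F0 F0J large]] : exists D, exists2 F : seq {poly R}, (forall p, p \in F -> J p) &
    forall d a, (D <= d)%N -> leading J d a -> leading (ideal (fun p => p \in F)) d a.
  have [l lJ Jl] := noethR (fun a => exists d, leading J d a).
  have [D lD] : exists D, forall a, a \in l -> leading J D a.
    elim: l lJ {Jl} => [|a l IH] lJ; first by exists 0%N.
    have [|D lD] := IH; first by move=> b bl; apply: lJ; rewrite inE bl orbT.
    have [|d da] := lJ a; first by rewrite inE eqxx.
    exists (maxn d D) => b; rewrite inE => /orP[/eqP->|/lD].
      by apply: leading_leq da; [exact: JJ | exact: leq_maxl].
    by apply: leading_leq; [exact: JJ | exact: leq_maxr].
  have [F FJ Fl] := fin D l lD; exists D, F => // d a Dd ad.
  have la : ideal (fun b => b \in l) a by apply: Jl; exists d.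
  apply: leading_ideal; first exact: JJ.
  apply: ideal_sub la => b /Fl bF; apply: ideal_gen.
  by apply: leading_leq Dd bF; exact: JJ.
have [F FJ Flead] : exists2 F : seq {poly R}, (forall p, p \in F -> J p) &
    forall d a, leading J d a -> leading (ideal (fun p => p \in F)) d a.
  have [F1 F1J small] : exists2 F : seq {poly R}, (forall p, p \in F -> J p) &
      forall d a, (d < D)%N -> leading J d a -> leading (ideal (fun p => p \in F)) d a.
    elim: D {large} => [|D [F FJ IH]]; first by exists [::].
    have [F' FJ' h] := at_degree D; exists (F ++ F') => [p|d a].
      by rewrite mem_cat => /orP[/FJ|/FJ'].
    rewrite ltnS leq_eqVlt => /orP[/eqP->|dD] /[dup] ad; last move=> /(IH _ _ dD); move: ad => _.
      by move=> /h[p [Fp sp pa]]; exists p; split=> //; apply: ideal_sub Fp => g gF;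
        apply: ideal_gen; rewrite mem_cat gF orbT.
    by move=> [p [Fp sp pa]]; exists p; split=> //; apply: ideal_sub Fp => g gF;
      apply: ideal_gen; rewrite mem_cat gF.
  exists (F0 ++ F1) => [p|d a ad]; first by rewrite mem_cat => /orP[/F0J|/F1J].
  have [Dd|dD] := leqP D d.
    have [p [Fp sp pa]] := large d a Dd ad; exists p; split=> //.
    by apply: ideal_sub Fp => g gF; apply: ideal_gen; rewrite mem_cat gF.
  have [p [Fp sp pa]] := small d a dD ad; exists p; split=> //.
  by apply: ideal_sub Fp => g gF; apply: ideal_gen; rewrite mem_cat gF orbT.
have [l lS lF] := ideal_finite_seq FJ; exists l => // p Sp.
apply: (ideal_sub lF); have {Sp} : J p by exact: ideal_gen.
have [n] := ubnP (size p); elim: n p => // n IH p sp Jp.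
have [->|p0] := eqVneq p 0; first exact: ideal_zero.
have [g [Fg sg gp]] : leading (ideal (fun p => p \in F)) (size p).-1 p`_(size p).-1.
  by apply: Flead; exists p; split=> //; rewrite leqSpred.
rewrite -(subrK g p); apply: ideal_add => //.
have Jg : J g by apply: ideal_sub Fg; exact: FJ.
apply: IH; last exact: idealB.
have sp0 : (0 < size p)%N by rewrite size_poly_gt0.
apply: leq_ltn_trans (_ : _ <= (size p).-1)%N _; last by rewrite prednK.
apply/leq_sizeP => j; rewrite leq_eqVlt coefB => /orP[/eqP<-|pj]; first by rewrite gp subrr.
rewrite !nth_default ?subrr //; last by rewrite -(prednK sp0).
by apply: leq_trans sg pj.
Qed.

End Hilbert.

Lemma noetherian_surj (A B : comNzRingType) (phi : {rmorphism A -> B}) :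
  (forall b, exists a, phi a = b) -> noetherian A -> noetherian B.
Proof.
move=> surj noethA S; have [l lS Sl] := noethA (fun a => S (phi a)).
exists (map phi l) => [b /mapP[a al ->]|b]; first exact: lS.
have [a <-] := surj b; move/Sl; elim=> {b a} [a al||a b _ ha _ hb|c a _ ha].
- by apply: ideal_gen; apply: map_f.
- by rewrite rmorph0; exact: ideal_zero.
- by rewrite rmorphD; exact: ideal_add.
- by rewrite rmorphM; exact: ideal_mul.
Qed.

Lemma noetherian_cover (B : comNzRingType) (bs : seq B) :
  exists (P : comNzRingType) (phi : {rmorphism P -> B}),
    noetherian P /\ forall b, b \in bs -> exists p, phi p = b.
Proof.
elim: bs => [|b bs [P [phi [noethP phi_bs]]]].
  by exists int, intr; split=> //; exact: noetherian_int.
have cphi : commr_rmorph phi b by move=> x; exact: mulrC.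
exists {poly P}, (horner_morph cphi); split; first exact: noetherian_poly.
move=> b'; rewrite inE => /orP[/eqP->|/phi_bs[p <-]].
  by exists 'X; exact: horner_morphX.
by exists p%:P; exact: horner_morphC.
Qed.

Lemma noetherian_mpoly n : noetherian {mpoly int[n]}.
Proof.
have [P [phi [noethP phiX]]] := noetherian_cover [seq 'X_i : {mpoly int[n]} | i <- enum 'I_n].
apply: noetherian_surj noethP; apply: mpoly_int_ind.
- by exists 1; rewrite rmorph1.
- by move=> i; apply: phiX; apply: map_f; rewrite mem_enum.
- by move=> _ _ [p <-] [p' <-]; exists (p + p'); rewrite rmorphD.
- by move=> _ [p <-]; exists (- p); rewrite rmorphN.
- by move=> _ _ [p <-] [p' <-]; exists (p * p'); rewrite rmorphM.
Qed.

(** * Schemes of finite type are combinations of affine systems *)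

Lemma rmorphism_of (A B : pzRingType) (f : A -> B) :
  f 1 = 1 -> {morph f : x y / x - y} -> {morph f : x y / x * y} ->
  exists phi : {rmorphism A -> B}, phi =1 f.
Proof.
move=> f1 fB fM.
pose fA := GRing.isZmodMorphism.Build A B f fB.
pose fR := GRing.isMonoidMorphism.Build A B f (conj f1 fM).
pose phi : {rmorphism A -> B} := HB.pack f fA fR.
by exists phi.
Qed.

Lemma ract_ext (X : ring_functor) (R S : comPzRingType) (f g : {rmorphism R -> S}) x :
  f =1 g -> ract f x = ract (r := X) g x.
Proof.
move=> fg; have [i iE] := @rmorphism_of R R id erefl (fun _ _ => erefl) (fun _ _ => erefl).
rewrite (@ract_comp X _ _ _ i g f) => [|y]; last by rewrite /= iE fg.
by rewrite ract_id.
Qed.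

Lemma generates_unit_ideal_field (K : fieldType) (I : K -> Prop) :
  generates_unit_ideal I <-> exists2 a, I a & a != 0.
Proof.
split=> [[n [a [c [aI e]]]]|[a Ia a0]].
  apply: contrapT => h; have /eqP := e; rewrite big1 ?(eq_sym 0) ?oner_eq0 // => i _.
  suff -> : a i = 0 by rewrite mulr0.
  by apply/eqP; apply: contra_notT h => ai; exists (a i).
exists 1%N, (fun=> a), (fun=> a^-1); split=> //.
by rewrite big_ord1 mulVf.
Qed.

Definition stratum (X : ring_functor) n (U : 'I_n -> forall R : comPzRingType, X R -> Prop)
    (i : 'I_n) (R : comPzRingType) (x : X R) : Prop :=
  U i R x /\ forall j : 'I_n, (j < i)%N -> ~ U j R x.

(** Over a field a point of U_i is a morphism from A, and it avoids U_j exactly when it kills all of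
    [J j], because a set generates the unit ideal only if it has a nonzero element. The relations of
    A and the sets [J j] may be infinite, hence the basis theorem. *)
Lemma stratum_zeros (X : ring_functor) n (U : 'I_n -> forall R : comPzRingType, X R -> Prop) i :
  (forall j, open_subfunctor (U j)) ->
  (exists (A : comPzRingType) (u : X A), finitely_generated_ring A /\ represents (U i) u) ->
  exists (m : nat) (es : seq (rexp m)), forall q, exists h : X (Fq q) -> {ffun 'I_m -> Fq q},
    [/\ forall x, stratum U i x -> zeros es (h x),
        forall y, zeros es y -> exists2 x, stratum U i x & h x = y
      & forall x x', stratum U i x -> stratum U i x' -> h x = h x' -> x = x'].
Proof.
move=> openU [A [u [[m [p p_surj]] [uU u_inj u_surj]]]].
have /choice[J JE] : forall j, exists I : A -> Prop, forall (R : comPzRingType) (f : {rmorphism A -> R}),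
    U j R (ract f u) <-> generates_unit_ideal (fun b : R => exists2 a, I a & b = f a).
  by move=> j; have [_ /(_ A u)] := openU j.
pose S (P : {mpoly int[m]}) := p P = 0 \/ exists2 j : 'I_n, (j < i)%N & J j (p P).
have [l lS Sl] := noetherian_mpoly S.
have /choice[e eE] := @mpoly_int_rexp m.
exists m, (map e l) => q; set K := Fq q.
have zerosE (y : {ffun 'I_m -> K}) : zeros (map e l) y <-> forall P, S P -> ieval y P = 0.
  rewrite /zeros all_map; split=> [/allP h P /Sl|h].
    elim=> {P} [P Pl||P P' _ e1 _ e2|c P _ e1].
    - by rewrite eE; apply/eqP; exact: h.
    - by rewrite rmorph0.
    - by rewrite rmorphD e1 e2 addr0.
    - by rewrite rmorphM e1 mulr0.
  by apply/allP => P Pl /=; rewrite -eE h //; exact: lS.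
(* Points outside U_i get the arbitrary value 0; only points of the stratum are ever compared. *)
have /choice[h hE] : forall x : X K, exists y : {ffun 'I_m -> K},
    forall f : {rmorphism A -> K}, ract f u = x -> forall k, y k = f (p 'X_k).
  move=> x; have [[f fx]|nx] := pselect (exists f : {rmorphism A -> K}, ract f u = x).
    exists [ffun k => f (p 'X_k)] => f' f'x k; rewrite ffunE; apply: u_inj.
    by rewrite fx f'x.
  by exists [ffun=> 0] => f fx; case: nx; exists f.
have ieval_h (f : {rmorphism A -> K}) P : ieval (h (ract f u)) P = f (p P).
  apply: (mpoly_int_morph_eq (phi := ieval _) (psi := f \o p)) => k.
  by rewrite ievalX (hE _ f).
exists h; split.
- move=> x [/u_surj[f <-] nU]; apply/zerosE => P [p0|[j ji Jp]]; rewrite ieval_h.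
    by rewrite p0 rmorph0.
  apply/eqP; apply: contra_notT (nU j ji) => fp; apply/JE/generates_unit_ideal_field.
  by exists (f (p P)) => //; exists (p P).
- move=> y /zerosE y0; have /choice[r rE] := p_surj.
  have wd P P' : p P = p P' -> ieval y P = ieval y P'.
    by move=> pe; apply/eqP; rewrite -subr_eq0 -rmorphB; apply/eqP/y0; left; rewrite rmorphB pe subrr.
  pose v a := ieval y (r a).
  have v1 : v 1 = 1 by rewrite -(rmorph1 (ieval y)); apply: wd; rewrite rE rmorph1.
  have vB : {morph v : a b / a - b}.
    by move=> a b; rewrite -rmorphB; apply: wd; rewrite rmorphB !rE.
  have vM : {morph v : a b / a * b}.
    by move=> a b; rewrite -rmorphM; apply: wd; rewrite rmorphM !rE.
  have [f fE] := rmorphism_of v1 vB vM.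
  have fp P : f (p P) = ieval y P by rewrite fE; apply: wd; rewrite rE.
  exists (ract f u); last by apply/ffunP => k; rewrite (hE _ f) // fp ievalX.
  split=> [|j ji /JE/generates_unit_ideal_field[_ [a Ja ->]]]; first exact: uU.
  rewrite -(rE a) fp y0 ?eqxx //; right; exists j => //.
  by rewrite rE.
- move=> x x' [/u_surj[f <-] _] [/u_surj[f' <-] _] hh; apply: ract_ext => a.
  by have [P <-] := p_surj a; rewrite -!ieval_h hh.
Qed.

Lemma Graphs_scheme (X : ring_functor) f : scheme_of_finite_type X -> counts_points X f -> Graphs f.
Proof.
move=> [_ [n [U [openU reprU coverU]]]] Xf.
have /choice[F FE] : forall i, exists F : {m : nat & seq (rexp m)}, forall q,
    exists h : X (Fq q) -> {ffun 'I_(tag F) -> Fq q},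
    [/\ forall x, stratum U i x -> zeros (tagged F) (h x),
        forall y, zeros (tagged F) y -> exists2 x, stratum U i x & h x = y
      & forall x x', stratum U i x -> stratum U i x' -> h x = h x' -> x = x'].
  by move=> i; have [m [es esE]] := stratum_zeros openU (reprU i); exists (existT _ m es).
apply: span_ext (Graphs_sum (fun i => Graphs_zeros (tagged (F i)))) => q.
have [N [g [g' gK g'K]] ->] := Xf q.
pose A i : {set 'I_N} := [set t | `[< stratum U i (g' t) >]].
have cardA i : #|A i| = #|[set y : {ffun 'I_(tag (F i)) -> Fq q} | zeros (tagged (F i)) y]|.
  have [h [h1 h2 h3]] := FE i q.
  rewrite -(card_in_imset (f := h \o g')) => [|t t'].
    apply: eq_card => y; rewrite inE; apply/imsetP/idP => [[t]|/h2[x sx <-]].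
      by rewrite inE => /asboolP st ->; exact: h1.
    exists (g x); last by rewrite /= gK.
    by rewrite inE gK; apply/asboolP.
  by rewrite !inE => /asboolP st /asboolP st' /(h3 _ _ st st')/(can_inj g'K).
under eq_bigr => i _ do rewrite -cardA.
rewrite -natr_sum; congr (_%:R); rewrite -[RHS]card_ord -sum1_card.
under eq_bigr => i _ do rewrite -sum1_card big_mkcond.
rewrite exchange_big; apply: eq_bigr => t _ /=.
(* A point belongs to exactly one stratum, that of the least index whose open contains it. *)
have [i0 Ui0] : exists i, `[< U i _ (g' t) >] by have [i Ui] := coverU _ (g' t); exists i; apply/asboolP.
case: (arg_minnP (P := fun i => `[< U i _ (g' t) >]) (fun i : 'I_n => i : nat) Ui0) => i /asboolP Ui i_min.
have tE j : (t \in A j) = (j == i).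
  rewrite inE; apply/asboolP/eqP => [[Uj nU]|->].
    apply/val_inj/eqP; rewrite eqn_leq; apply/andP; split; last by apply: i_min; apply/asboolP.
    by rewrite leqNgt; apply/negP => /nU.
  split=> // k ki /asboolP Uk; have := i_min k Uk; by rewrite leqNgt ki.
by rewrite (bigD1 i) //= tE eqxx big1 // => j /negPf ji; rewrite tE ji.
Qed.

Lemma Mot_sub_Graphs f : Mot f -> Graphs f.
Proof.
move=> [g [s [Mg sS fE]]]; apply: (Graphs_div sS (g := g)) => [|q]; last first.
  by rewrite fE mulrC divfK // satS_neq0.
elim: Mg => {f fE g} [f [X [schX Xf]]||f g _ hf _ hg|a f [z az] _ hf|f g fg _ hf].
- exact: Graphs_scheme schX Xf.
- exact: span_zero.
- exact: GraphsD.
- by apply: span_ext (GraphsZp z%:P hf) => q; rewrite az pvalC.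
- exact: span_ext fg hf.
Qed.

(** * Affine schemes *)

Lemma reval_morph n (R S : pzRingType) (phi : {rmorphism R -> S}) (x : 'I_n -> R) e :
  phi (reval x e) = reval (phi \o x) e.
Proof.
elim: e => /= [||i|e1 IH1 e2 IH2|e IH|e1 IH1 e2 IH2] //.
- exact: rmorph0.
- exact: rmorph1.
- by rewrite rmorphD IH1 IH2.
- by rewrite rmorphN IH.
- by rewrite rmorphM IH1 IH2.
Qed.

HB.instance Definition _ n := gen_eqMixin (rexp n).
HB.instance Definition _ n := gen_choiceMixin (rexp n).

(** * The ring of functions of a system of equations *)

Section CoordinateRing.

Local Open Scope quotient_scope.
Local Notation qrepr := generic_quotient.repr.

Variables (n : nat) (es : seq (rexp n)).

(* Since this quantifies over all rings, each ring axiom of the quotient reduces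
   to the same axiom in the rings R. *)
Definition rexp_equiv (e e' : rexp n) : bool :=
  `[< forall (R : comPzRingType) (x : {ffun 'I_n -> R}), zeros es x -> reval x e = reval x e' >].

Lemma rexp_equiv_is_equiv : equiv_class_of rexp_equiv.
Proof.
split=> [e|e e'|e1 e2 e3]; first exact/asboolP.
  by apply/asboolP/asboolP => h R x sx; rewrite h.
by move=> /asboolP h /asboolP h'; apply/asboolP => R x sx; rewrite h ?h'.
Qed.

Canonical rexp_equiv_equiv := EquivRelPack rexp_equiv_is_equiv.
Canonical rexp_equiv_encModRel := defaultEncModRel rexp_equiv.

Definition coord_ring := {eq_quot rexp_equiv}.
HB.instance Definition _ := Choice.on coord_ring.
HB.instance Definition _ := EqQuotient.on coord_ring.

Definition ev (R : comPzRingType) (x : {ffun 'I_n -> R}) (a : coord_ring) : R := reval x (qrepr a).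

Lemma ev_pi (R : comPzRingType) (x : {ffun 'I_n -> R}) e : zeros es x ->
  ev x (\pi_coord_ring e) = reval x e.
Proof.
move=> sx; rewrite /ev; have /eqmodP/asboolP h : qrepr (\pi_coord_ring e) = e %[mod coord_ring].
  by rewrite reprK.
exact: h.
Qed.

Lemma ev_inj (a b : coord_ring) :
  (forall (R : comPzRingType) (x : {ffun 'I_n -> R}), zeros es x -> ev x a = ev x b) -> a = b.
Proof.
move=> h; rewrite -[a]reprK -[b]reprK; apply/eqmodP/asboolP => R x sx.
exact: h.
Qed.

Definition cr_zero : coord_ring := \pi_coord_ring RZero.
Definition cr_one : coord_ring := \pi_coord_ring ROne.
Definition cr_add (a b : coord_ring) : coord_ring := \pi_coord_ring (RAdd (qrepr a) (qrepr b)).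
Definition cr_opp (a : coord_ring) : coord_ring := \pi_coord_ring (ROpp (qrepr a)).
Definition cr_mul (a b : coord_ring) : coord_ring := \pi_coord_ring (RMul (qrepr a) (qrepr b)).

Lemma ev_zero (R : comPzRingType) (x : {ffun 'I_n -> R}) : zeros es x -> ev x cr_zero = 0.
Proof. exact: ev_pi. Qed.
Lemma ev_one (R : comPzRingType) (x : {ffun 'I_n -> R}) : zeros es x -> ev x cr_one = 1.
Proof. exact: ev_pi. Qed.
Lemma ev_add (R : comPzRingType) (x : {ffun 'I_n -> R}) a b : zeros es x ->
  ev x (cr_add a b) = ev x a + ev x b.
Proof. exact: ev_pi. Qed.
Lemma ev_opp (R : comPzRingType) (x : {ffun 'I_n -> R}) a : zeros es x ->
  ev x (cr_opp a) = - ev x a.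
Proof. exact: ev_pi. Qed.
Lemma ev_mul (R : comPzRingType) (x : {ffun 'I_n -> R}) a b : zeros es x ->
  ev x (cr_mul a b) = ev x a * ev x b.
Proof. exact: ev_pi. Qed.

Let evE := (ev_zero, ev_one, ev_add, ev_opp, ev_mul).

Lemma cr_addA : associative cr_add.
Proof. by move=> a b c; apply: ev_inj => R x sx; rewrite !evE // addrA. Qed.
Lemma cr_addC : commutative cr_add.
Proof. by move=> a b; apply: ev_inj => R x sx; rewrite !evE // addrC. Qed.
Lemma cr_add0 : left_id cr_zero cr_add.
Proof. by move=> a; apply: ev_inj => R x sx; rewrite !evE // add0r. Qed.
Lemma cr_addN : left_inverse cr_zero cr_opp cr_add.
Proof. by move=> a; apply: ev_inj => R x sx; rewrite !evE // addNr. Qed.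
Lemma cr_mulA : associative cr_mul.
Proof. by move=> a b c; apply: ev_inj => R x sx; rewrite !evE // mulrA. Qed.
Lemma cr_mulC : commutative cr_mul.
Proof. by move=> a b; apply: ev_inj => R x sx; rewrite !evE // mulrC. Qed.
Lemma cr_mul1 : left_id cr_one cr_mul.
Proof. by move=> a; apply: ev_inj => R x sx; rewrite !evE // mul1r. Qed.
Lemma cr_mulD : left_distributive cr_mul cr_add.
Proof. by move=> a b c; apply: ev_inj => R x sx; rewrite !evE // mulrDl. Qed.

HB.instance Definition _ :=
  GRing.isZmodule.Build coord_ring cr_addA cr_addC cr_add0 cr_addN.
HB.instance Definition _ :=
  GRing.Zmodule_isComPzRing.Build coord_ring cr_mulA cr_mulC cr_mul1 cr_mulD.

Definition cr_var (i : 'I_n) : coord_ring := \pi_coord_ring (RVar i).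

Lemma reval_cr_var e : reval cr_var e = \pi_coord_ring e.
Proof.
suff E e' : reval cr_var e' = \pi_coord_ring e' by [].
apply: ev_inj => R x sx; rewrite ev_pi //.
elim: e' => /= [||i|e1 IH1 e2 IH2|e' IH|e1 IH1 e2 IH2].
- exact: ev_zero.
- exact: ev_one.
- exact: ev_pi.
- by rewrite [LHS]ev_add // IH1 IH2.
- by rewrite [LHS]ev_opp // IH.
- by rewrite [LHS]ev_mul // IH1 IH2.
Qed.

(** The universal solution: an equation holds in the quotient because it holds at all solutions in
    all rings. *)
Lemma zeros_cr_var : zeros es [ffun i => cr_var i].
Proof.
apply/allP => e ees; rewrite (eq_reval _ (ffunE _)) reval_cr_var.
apply/eqP; apply: (ev_inj (b := cr_zero)) => R x sx; rewrite ev_pi // ev_zero //.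
exact/eqP/(allP sx).
Qed.

Lemma coord_ring_univ (R : comPzRingType) (x : {ffun 'I_n -> R}) : zeros es x ->
  exists f : {rmorphism coord_ring -> R}, forall i, f (cr_var i) = x i.
Proof.
move=> sx; have [|a b|a b|f fE] := @rmorphism_of coord_ring R (ev x).
- exact: ev_one.
- by rewrite [LHS]ev_add // ev_opp.
- exact: ev_mul.
by exists f => i; rewrite fE; exact: ev_pi.
Qed.

Lemma coord_ring_morph_eq (R : comPzRingType) (f g : {rmorphism coord_ring -> R}) :
  (forall i, f (cr_var i) = g (cr_var i)) -> f =1 g.
Proof.
move=> fg a; rewrite -[a]reprK -reval_cr_var !reval_morph.
exact: eq_reval.
Qed.

End CoordinateRing.

(** [ieval] takes its values in nonzero rings; the zero ring gets the constant morphism. *)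
Lemma mpoly_int_univ (A : comPzRingType) n (v : 'I_n -> A) :
  exists phi : {rmorphism {mpoly int[n]} -> A}, forall i, phi 'X_i = v i.
Proof.
have [A0|A1] := eqVneq (1 : A) 0.
  have A0E (a b : A) : a = b by rewrite -[a]mul1r -[b]mul1r A0 !mul0r.
  have [phi _] := @rmorphism_of {mpoly int[n]} A (fun=> 0) (A0E _ _)
    (fun _ _ => A0E _ _) (fun _ _ => A0E _ _).
  by exists phi.
pose nz := GRing.PzSemiRing_isNonZero.Build A A1.
pose A' : comNzRingType := HB.pack (GRing.ComPzRing.sort A) A nz.
pose phi : {rmorphism {mpoly int[n]} -> A} := ieval (v : 'I_n -> A').
by exists phi => i; exact: (@ievalX n A').
Qed.

Lemma coord_ring_fg n (es : seq (rexp n)) : finitely_generated_ring (coord_ring es).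
Proof.
have [phi phiX] := mpoly_int_univ (@cr_var n es).
exists n, phi => a; rewrite -[a]reprK -reval_cr_var.
elim: (generic_quotient.repr a) => /= [||i|e1 [P <-] e2 [P' <-]|e [P <-]|e1 [P <-] e2 [P' <-]].
- by exists 0; rewrite rmorph0.
- by exists 1; rewrite rmorph1.
- by exists 'X_i.
- by exists (P + P'); rewrite rmorphD.
- by exists (- P); rewrite rmorphN.
- by exists (P * P'); rewrite rmorphM.
Qed.

(* The elements having a power in the ideal P form an ideal. *)
Lemma unit_ideal_powers (R : comPzRingType) n (f : 'I_n -> R) (P : R -> Prop) :
  generates_unit_ideal (fun a => exists i, a = f i) ->
  P 0 -> (forall a b, P a -> P b -> P (a + b)) -> (forall c a, P a -> P (c * a)) ->
  (forall i, exists N, P (f i ^+ N)) -> P 1.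
Proof.
move=> [m [a [c [af ca]]]] P0 PD PM Pf.
have PS (I : finType) (F : I -> R) : (forall i, P (F i)) -> P (\sum_i F i).
  by move=> PF; elim: (index_enum I) => [|i r IH]; rewrite ?big_nil // big_cons; apply: PD.
have powP x N M : (N <= M)%N -> P (x ^+ N) -> P (x ^+ M).
  by move=> NM PN; rewrite -(subnK NM) exprD; apply: PM.
suff [N] : exists N, P ((\sum_(i < m) c i * a i) ^+ N) by rewrite ca expr1n.
elim: (index_enum _) => [|i r [N IH]]; first by exists 1%N; rewrite big_nil expr1.
have [j aj] := af i; have [M PM'] := Pf j; exists (M + N)%N; rewrite big_cons exprDn.
apply: PS => k; rewrite -mulr_natr mulrC; apply: (PM _ _).
have [Nk|kN] := leqP N k; first by apply: (PM _ _); exact: powP IH.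
rewrite mulrC; apply: (PM _ _); rewrite exprMn; apply: (PM _ _); rewrite aj.
by apply: powP PM'; lia.
Qed.

(** * Zariski descent for elements of a ring *)

Section Gluing.

Variables (R : comPzRingType) (n : nat) (f : 'I_n -> R).
Variables (Ri : 'I_n -> comPzRingType) (l : forall i, {rmorphism R -> Ri i}).
Variables (Rij : 'I_n -> 'I_n -> comPzRingType).
Variables (l1 : forall i j, {rmorphism Ri i -> Rij i j}).
Variables (l2 : forall i j, {rmorphism Ri j -> Rij i j}).
Variables (l12 : forall i j, {rmorphism R -> Rij i j}).
Hypothesis f_gen : generates_unit_ideal (fun a => exists i, a = f i).
Hypothesis l_loc : forall i, is_localization (f i) (l i).
Hypothesis l12_loc : forall i j, is_localization (f i * f j) (l12 i j).
Hypothesis l1E : forall i j, l1 i j \o l i =1 l12 i j.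
Hypothesis l2E : forall i j, l2 i j \o l j =1 l12 i j.

(** The annihilator of y - y' is an ideal that contains a power of each [f i]. *)
Lemma localization_separated (y y' : R) : (forall i, l i y = l i y') -> y = y'.
Proof.
move=> yy'; suff : 1 * (y - y') = 0 by rewrite mul1r => /eqP; rewrite subr_eq0 => /eqP.
apply: (unit_ideal_powers (P := fun c => c * (y - y') = 0) f_gen); first by rewrite mul0r.
- by move=> a b a0 b0; rewrite mulrDl a0 b0 addr0.
- by move=> c a a0; rewrite -mulrA a0 mulr0.
- move=> i; have [_ _ l0] := l_loc i; apply: l0.
  by rewrite rmorphB yy' subrr.
Qed.

(** The elements t such that t s lifts to R form an ideal; clearing denominators puts a power of
    each [f k] in it, hence also 1. *)
Lemma localization_glue (s : forall i, Ri i) :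
  (forall i j, l1 i j (s i) = l2 i j (s j)) -> exists y, forall i, l i y = s i.
Proof.
move=> s12; suff [y yE] : exists y, forall i, l i y = l i 1 * s i.
  by exists y => i; rewrite yE rmorph1 mul1r.
apply: (unit_ideal_powers (P := fun t => exists y, forall i, l i y = l i t * s i) f_gen).
- by exists 0 => i; rewrite !rmorph0 mul0r.
- by move=> a b [y yE] [y' y'E]; exists (y + y') => i; rewrite !rmorphD yE y'E mulrDl.
- by move=> c a [y yE]; exists (c * y) => i; rewrite !rmorphM yE mulrA.
move=> k; have [_ l_frac _] := l_loc k; have [r [N rE]] := l_frac (s k).
(* The defect of r as a lift of f_k^N s. It vanishes in the localization at f_i f_k, so a power of
   f_k kills it in [Ri i]. *)
pose d i := l i r - l i (f k) ^+ N * s i.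
have d0 i : exists M, l i (f k) ^+ M * d i = 0.
  have [[u fu] li_frac _] := l_loc i; have [_ _ l120] := l12_loc i k.
  have [r' [N' r'E]] := li_frac (d i).
  have l1d : l1 i k (d i) = 0.
    rewrite rmorphB rmorphM rmorphXn -[l1 i k _]/((l1 i k \o l i) r) l1E.
    rewrite -[l1 i k (l i (f k))]/((l1 i k \o l i) (f k)) l1E s12 -!l2E /=.
    by rewrite -rmorphXn -rmorphM rE subrr.
  have [M r'0] : exists M, (f i * f k) ^+ M * r' = 0.
    by apply: l120; rewrite -l1E /= -r'E rmorphM l1d mulr0.
  exists M; have : l i ((f i * f k) ^+ M * r') = 0 by rewrite r'0 rmorph0.
  rewrite rmorphM rmorphXn rmorphM -r'E exprMn.
  move=> /(congr1 ( *%R (u ^+ (M + N')))); rewrite mulr0 => e; rewrite -[LHS]mul1r -[X in X * _](expr1n _ (M + N')).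
  by rewrite -fu exprMn -[RHS]e !exprD; ring.
have /choice[M ME] := d0; exists (N + \sum_i M i)%N, (f k ^+ (\sum_i M i) * r) => i.
rewrite !rmorphM !rmorphXn exprD.
have : l i (f k) ^+ (\sum_j M j) * d i = 0.
  by rewrite (bigD1 i) //= addnC exprD -mulrA ME mulr0.
rewrite /d mulrBr => /eqP; rewrite subr_eq0 => /eqP->.
by rewrite mulrA [_ ^+ N * _]mulrC.
Qed.

End Gluing.

Section AffineScheme.

Variables (n : nat) (es : seq (rexp n)).

Definition affine_points (R : comPzRingType) : Type := {x : {ffun 'I_n -> R} | zeros es x}.

Definition affine_point (R : comPzRingType) (x : {ffun 'I_n -> R}) (sx : zeros es x) :
  affine_points R := exist (fun y : {ffun 'I_n -> R} => zeros es y) x sx.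

Lemma zeros_morph (R S : comPzRingType) (phi : {rmorphism R -> S}) (x : {ffun 'I_n -> R}) :
  zeros es x -> zeros es [ffun i => phi (x i)].
Proof.
move=> /allP sx; apply/allP => e ees; rewrite (eq_reval (y := phi \o x)) => [|i]; last by rewrite ffunE.
by rewrite -reval_morph (eqP (sx e ees)) rmorph0.
Qed.

Definition affine_act (R S : comPzRingType) (phi : {rmorphism R -> S}) (x : affine_points R) :
  affine_points S := affine_point (zeros_morph phi (valP x)).

Lemma affine_act_id (R : comPzRingType) (phi : {rmorphism R -> R}) :
  phi =1 id -> forall x, affine_act phi x = x.
Proof. by move=> phiE x; apply/val_inj/ffunP => i; rewrite ffunE phiE. Qed.

Lemma affine_act_comp (R S T : comPzRingType) (phi : {rmorphism R -> S})
    (psi : {rmorphism S -> T}) (chi : {rmorphism R -> T}) :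
  chi =1 psi \o phi -> forall x, affine_act chi x = affine_act psi (affine_act phi x).
Proof. by move=> chiE x; apply/val_inj/ffunP => i; rewrite !ffunE chiE. Qed.

Definition affine_functor : ring_functor := RingFunctor affine_act_id affine_act_comp.

Lemma affine_sheaf : zariski_sheaf affine_functor.
Proof.
move=> R m f Ri l Rij l1 l2 l12 f_gen l_loc l12_loc l1E l2E x x12.
have x12' k i j : l1 i j (val (x i) k) = l2 i j (val (x j) k).
  by have := congr1 (fun z : affine_points _ => val z k) (x12 i j); rewrite !ffunE.
have /choice[y yE] k := localization_glue f_gen l_loc l12_loc l1E l2E (x12' k).
have sy : zeros es [ffun k => y k].
  apply/allP => e ees; apply/eqP; apply: (localization_separated f_gen l_loc) => i.
  rewrite rmorph0 reval_morph (eq_reval (y := val (x i))) => [|k]; last by rewrite /= ffunE yE.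
  exact/eqP/(allP (valP (x i))).
exists (affine_point sy); split=> [i|z zE]; first by apply/val_inj/ffunP => k; rewrite !ffunE yE.
apply/val_inj/ffunP => k; apply: (localization_separated f_gen l_loc) => i.
by rewrite ffunE yE -zE ffunE.
Qed.

Lemma affine_finite_type : scheme_of_finite_type affine_functor.
Proof.
split; first exact: affine_sheaf.
exists 1%N, (fun _ _ _ => True); split=> [_|_|K x]; last by exists ord0.
  split=> [//|A x]; exists (fun a => a = 1) => R phi; split=> // _.
  exists 1%N, (fun=> 1), (fun=> 1); split; last by rewrite big_ord1 mul1r.
  by move=> _; exists 1; rewrite ?rmorph1.
exists (coord_ring es), (affine_point (zeros_cr_var es)); split; first exact: coord_ring_fg.
split=> // [R phi psi e|R x _].
  apply: coord_ring_morph_eq => i.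
  by have := congr1 (fun z : affine_points _ => val z i) e; rewrite !ffunE.
have [phi phiE] := coord_ring_univ (valP x); exists phi.
by apply/val_inj/ffunP => i; rewrite !ffunE.
Qed.

Lemma affine_counts_points :
  counts_points affine_functor (fun q => #|[set x : {ffun 'I_n -> Fq q} | zeros es x]|%:R).
Proof.
move=> q; exists #|[set x : {ffun 'I_n -> Fq q} | zeros es x]| => //.
have -> : #|[set x : {ffun 'I_n -> Fq q} | zeros es x]| =
          #|{: {x : {ffun 'I_n -> Fq q} | zeros es x}}|.
  by rewrite card_sig; apply: eq_card => x; rewrite !inE.
exists enum_rank; exact: enum_rank_bij.
Qed.

End AffineScheme.

(** * The two inclusions *)

Fixpoint rlift n (e : rexp n) : rexp n.+1 :=
  match e with
  | RZero => RZero
  | ROne => ROne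
  | RVar i => RVar (lift ord0 i)
  | RAdd e1 e2 => RAdd (rlift e1) (rlift e2)
  | ROpp e1 => ROpp (rlift e1)
  | RMul e1 e2 => RMul (rlift e1) (rlift e2)
  end.

Lemma reval_rlift n (R : pzRingType) (x : 'I_n.+1 -> R) e :
  reval x (rlift e) = reval (fun i => x (lift ord0 i)) e.
Proof. by elim: e => //= [e1 -> e2 ->|e1 ->|e1 -> e2 ->]. Qed.

Lemma card_ffun_cons (K : finType) n (P : pred {ffun 'I_n.+1 -> K}) :
  #|[set x | P x]| =
  (\sum_(x : {ffun 'I_n -> K}) \sum_t P [ffun i => if unlift ord0 i is Some j then x j else t])%N.
Proof.
pose f (p : {ffun 'I_n -> K} * K) : {ffun 'I_n.+1 -> K} :=
  [ffun i => if unlift ord0 i is Some j then p.1 j else p.2].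
pose g (x : {ffun 'I_n.+1 -> K}) := ([ffun i => x (lift ord0 i)], x ord0).
have fK : cancel f g.
  move=> [x t]; rewrite /g ffunE unlift_none; congr (_, _).
  by apply/ffunP => i; rewrite !ffunE liftK.
have gK : cancel g f.
  by move=> x; apply/ffunP => i; rewrite !ffunE /=; case: unliftP => [j ->|->]; rewrite ?ffunE.
rewrite -sum1_card (reindex f) /=; last by exists g => x _; [exact: fK | exact: gK].
rewrite big_mkcond big_pair; apply: eq_bigr => x _; apply: eq_bigr => t _.
by rewrite inE.
Qed.

Definition zeros_count n (es : seq (rexp n)) (q : prime_power) : rat :=
  #|[set x : {ffun 'I_n -> Fq q} | zeros es x]|%:R.

(** For affine systems, multiplication by q is one more free variable. Keeping numerators in this
    span lets fractions be brought to a common denominator without products of general schemes. *)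
Definition affine_span : (prime_power -> rat) -> Prop :=
  span constZ (fun f => exists n (es : seq (rexp n)), f = zeros_count es).

Lemma affine_span_MotPlus f : affine_span f -> MotPlus f.
Proof.
elim=> {f} [f [n [es ->]]||f g _ hf _ hg|a f az _ hf|f g fg _ hf].
- apply: span_gen; exists (affine_functor es).
  by split; [exact: affine_finite_type | exact: affine_counts_points].
- exact: span_zero.
- exact: span_add.
- exact: span_scale.
- exact: span_ext fg hf.
Qed.

Lemma affine_spanX f : affine_span f -> affine_span (fun q => pval 'X q * f q).
Proof.
elim=> {f} [f [n [es ->]]||f g _ hf _ hg|a f az _ hf|f g fg _ hf].
- apply: (@span_ext _ _ (zeros_count (map (@rlift n) es))) => [q|]; last first.
    by apply: span_gen; exists n.+1, (map (@rlift n) es).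
  rewrite pvalX /zeros_count -natrM card_ffun_cons; congr (_%:R).
  rewrite -[in RHS]sum1_card [in RHS]big_mkcond big_distrr; apply: eq_bigr => x _ /=.
  rewrite inE -{1}(card_Fq q) -sum_nat_const; apply: eq_bigr => t _.
  rewrite /zeros all_map /=; set b := all _ _; have -> : b = all (fun e => reval x e == 0) es.
    apply: eq_all => e /=; rewrite reval_rlift; congr (_ == _).
    by apply: eq_reval => i; rewrite ffunE liftK.
  by case: (all _ _).
- by apply: span_ext (span_zero _ _) => q; rewrite mulr0.
- by apply: span_ext (span_add hf hg) => q; rewrite mulrDr.
- by apply: span_ext (span_scale az hf) => q; rewrite mulrCA.
- by apply: span_ext hf => q; rewrite fg.
Qed.

Lemma affine_spanZ p f : affine_span f -> affine_span (fun q => pval p q * f q).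
Proof.
move=> hf; elim/poly_ind: p => [|p c IH].
  by apply: span_ext (span_zero _ _) => q; rewrite pval0 mul0r.
apply: span_ext (span_add (affine_spanX IH) (span_scale (a := fun=> c%:~R) _ hf)).
  by move=> q; rewrite pvalD pvalM pvalC; ring.
by exists c.
Qed.

Lemma affine_span_countY G : affine_span (countY G).
Proof.
have [e eE] := mpoly_int_rexp (graph_poly G).
pose es := [:: RAdd (RMul (RVar ord0) (rlift e)) (ROpp ROne)].
apply: (@span_ext _ _ (zeros_count es)) => [q|]; last by apply: span_gen; exists #|edges G|.+1, es.
rewrite /zeros_count card_ffun_cons /countY -[in RHS]sum1_card [in RHS]big_mkcond; congr (_%:R).
pose f (x : {ffun edges G -> Fq q}) : {ffun 'I_#|edges G| -> Fq q} := [ffun i => x (enum_val i)].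
pose g (x : {ffun 'I_#|edges G| -> Fq q}) : {ffun edges G -> Fq q} := [ffun e => x (enum_rank e)].
have fK : cancel f g by move=> x; apply/ffunP => i; rewrite !ffunE enum_rankK.
have gK : cancel g f by move=> x; apply/ffunP => i; rewrite !ffunE enum_valK.
rewrite [LHS](reindex f); last by exists g => x _; [exact: fK | exact: gK].
apply: eq_bigr => x _; rewrite inE ievalE eE.
set a := reval _ e.
have zE t : zeros es [ffun i => if unlift ord0 i is Some j then f x j else t] = (t * a == 1).
  rewrite /zeros /= andbT ffunE unlift_none subr_eq0 reval_rlift; congr (_ * _ == _).
  by apply: eq_reval => i; rewrite !ffunE liftK ffunE.
under eq_bigr => t _ do rewrite zE.
have [a0|a0] := eqVneq a 0; first by rewrite big1 // => t _; rewrite a0 mulr0 eq_sym oner_eq0.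
rewrite (bigD1 a^-1) //= mulVf // eqxx big1 // => t ta.
by case: eqP => // e1; rewrite -(mulfK a0 t) e1 mul1r eqxx in ta.
Qed.

Lemma Graphs_sub_Mot f : Graphs f -> Mot f.
Proof.
suff: Graphs f -> exists g s, [/\ affine_span g, satS s & forall q, f q = g q / pval s q].
  by move=> h /h[g [s [/affine_span_MotPlus hg sS fE]]]; exists g, s.
elim=> {f} [f [G fG]||f f' _ [g [s [hg sS fE]]] _ [g' [s' [hg' sS' fE']]]|
   a f [p [t [tS aE]]] _ [g [s [hg sS fE]]]|f f' ff' _ [g [s [hg sS fE]]]].
- exists (countY G), 1; split=> [||q]; [exact: affine_span_countY | exact: satS_one |].
  by rewrite fG pval1 divr1.
- exists (fun=> 0), 1; split=> [||q]; [exact: span_zero | exact: satS_one |].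
  by rewrite mul0r.
- exists (fun q => pval s' q * g q + pval s q * g' q), (s * s'); split=> [||q].
  + by apply: span_add; exact: affine_spanZ.
  + exact: satS_mul.
  + have := satS_neq0 q sS; have := satS_neq0 q sS' => s0' s0.
    by rewrite fE fE' pvalM; field; rewrite s0 s0'.
- exists (fun q => pval p q * g q), (t * s); split=> [||q].
  + exact: affine_spanZ.
  + exact: satS_mul.
  + by rewrite aE fE pvalM mulf_div.
- by exists g, s; split=> // q; rewrite -ff'.
Qed.

Theorem theorem1p2 (f : prime_power -> rat) : Graphs f <-> Mot f.
Proof. by split; [exact: Graphs_sub_Mot | exact: Mot_sub_Graphs]. Qed.
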